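(* Let $n\ge3$ be odd. Each $\xi\in\mathcal{M}$ is not a local minimizer of $J_{\frac n2,1}$ in $W^{1,\frac n2}$.
   Context: All integrals are over the unit round sphere $(\mathbb{S}^n,g_{\rm st})$ with its standard volume element $dV$, and $W^{1,\frac n2}$ denotes the Sobolev space of $1$-forms on $\mathbb{S}^n$. For a $1$-form $\alpha$, $\mathrm{curl}\,\alpha=*d\alpha$, where $d$ is the exterior derivative and $*$ the Hodge star, so $|\mathrm{curl}\,\alpha|=|d\alpha|$ pointwise. For $1$-forms $\alpha\not\equiv0$, $$J_{\frac n2,1}(\alpha)=\frac{\big(\int|\mathrm{curl}\,\alpha|^{\frac n2}\,dV\big)^2}{\int|\alpha|^n\,dV}.$$ This quotient is conformally invariant. It is the case $k=1$, $p=\frac n2$ of $J_{p,k}(\alpha)=\big(\int|\mathrm{curl}\,\alpha|^p\,dV\big)^{q/p}\big/\int|\alpha|^q\,dV$ for $k$-forms $\alpha$, where $1<p<n$ and $q=\frac{np}{n-p}$. A Killing $1$-form on $\mathbb{S}^n$ is a co-closed $1$-form $\xi$ satisfying $\nabla_X\xi=\frac12\,X\lrcorner\, d\xi$ for every vector field $X$, where $\nabla$ is the Levi-Civita connection and $\lrcorner$ is interior multiplication; equivalently, $\xi$ is the metric dual of a Killing vector field. The set $\mathcal{M}$ consists of the Killing forms and their conformal transformations. For the functional $J_{\frac n2,1}$ on $1$-forms this means all not identically zero Killing $1$-forms on $\mathbb{S}^n$ together with their pullbacks under conformal diffeomorphisms of $\mathbb{S}^n$. A form $\xi$ is a local minimizer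 of $J_{\frac n2,1}$ in $W^{1,\frac n2}$ if $J_{\frac n2,1}(\alpha)\ge J_{\frac n2,1}(\xi)$ for all $\alpha$ in some $W^{1,\frac n2}$-neighborhood of $\xi$. *)

(* Defs.v *)
From HB Require Import structures.
From mathcomp Require Import all_boot all_order all_algebra.
From mathcomp Require Import all_classical all_reals all_analysis.
From mathcomp Require Import measurable_realfun.

Set Implicit Arguments.
Unset Strict Implicit.
Unset Printing Implicit Defensive.

Import Order.TTheory GRing.Theory Num.Theory.
Import numFieldNormedType.Exports.
Local Open Scope classical_set_scope.
Local Open Scope ring_scope.

Definition rV_display : measure_display.
Proof. exact: default_measure_display. Qed.

(* The sigma-algebra generated by the coordinates, that is, the Borel
   sigma-algebra of R^m. *)
Section rV_measurable.
Variables (R : realType) (m : nat).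

Definition rV_cylinder : set (set 'rV[R]_m) :=
  [set A | exists (i : 'I_m) (B : set R),
     measurable B /\ A = (fun x : 'rV[R]_m => x ord0 i) @^-1` B].

HB.instance Definition _ := @isMeasurable.Build rV_display 'rV[R]_m
  <<s rV_cylinder >> (@sigma_algebra0 _ setT rV_cylinder)
  (@sigma_algebraC _ rV_cylinder) (@sigma_algebra_bigcup _ setT rV_cylinder).

Lemma measurable_coord (i : 'I_m) :
  measurable_fun setT (fun x : 'rV[R]_m => x ord0 i).
Proof.
by move=> _ B mB; rewrite setTI; apply: sub_sigma_algebra; exists i, B.
Qed.

Lemma measurable_rV d (T : measurableType d) (f : T -> 'rV[R]_m) :
  (forall i, measurable_fun setT (fun t => f t ord0 i)) -> measurable_fun setT f.
Proof.
move=> mf; apply: (measurability rV_cylinder) => // _ [_ [i [B [mB ->]]] <-].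
exact: mf.
Qed.

End rV_measurable.

Section lebesgue_rV.
Variable R : realType.

Definition rV_cons m (p : R * 'rV[R]_m) : 'rV[R]_m.+1 :=
  \row_i (if unlift ord0 i is Some j then p.2 ord0 j else p.1).

Definition rV_uncons m (x : 'rV[R]_m.+1) : R * 'rV[R]_m :=
  (x ord0 ord0, \row_j x ord0 (lift ord0 j)).

Lemma rV_uncons_cons m : cancel (@rV_cons m) (@rV_uncons m).
Proof.
case=> a v; rewrite /rV_uncons /rV_cons mxE unlift_none; congr pair.
by apply/rowP => j; rewrite !mxE liftK.
Qed.

Lemma measurable_rV_cons m : measurable_fun setT (@rV_cons m).
Proof.
apply: measurable_rV => i; rewrite /rV_cons.
under eq_fun do rewrite mxE.
case: unliftP => [j _|_]; last exact: measurable_fst.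
exact: measurableT_comp (measurable_coord j) measurable_snd.
Qed.

Lemma measurable_rV_uncons m : measurable_fun setT (@rV_uncons m).
Proof.
apply/measurable_fun_pairP; split; first exact: measurable_coord.
apply: measurable_rV => j; rewrite /rV_uncons /=.
by under eq_fun do rewrite mxE; exact: measurable_coord.
Qed.

Section cons_measure.
Variables (m : nat) (mu : {sigma_finite_measure set 'rV[R]_m -> \bar R}).

Definition cons_measure : set 'rV[R]_m.+1 -> \bar R :=
  pushforward (@lebesgue_measure R \x mu)%E (@rV_cons m).

Let cons_measure0 : cons_measure set0 = 0%E.
Proof. by apply: measure0; exact: measurable_rV_cons. Qed.

Let cons_measure_ge0 A : (0 <= cons_measure A)%E.
Proof. by apply: measure_ge0; exact: measurable_rV_cons. Qed.

Let cons_measure_sigma_additive : semi_sigma_additive cons_measure.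
Proof. by apply: measure_semi_sigma_additive; exact: measurable_rV_cons. Qed.

HB.instance Definition _ := isMeasure.Build _ _ _ cons_measure
  cons_measure0 cons_measure_ge0 cons_measure_sigma_additive.

Let cons_measure_sigma_finite : sigma_finite setT cons_measure.
Proof.
have /sigma_finiteP[F [TF ndF Foo]] := sigma_finiteT (@lebesgue_measure R).
have /sigma_finiteP[G [TG ndG Goo]] := sigma_finiteT mu.
exists (fun k => @rV_uncons m @^-1` (F k `*` G k)).
  rewrite -preimage_bigcup (_ : \bigcup_k _ = setT) ?preimage_setT//.
  apply/seteqP; split => // -[a v] _.
  have [i _ Fi] : (\bigcup_k F k) a by rewrite -TF.
  have [j _ Gj] : (\bigcup_k G k) v by rewrite -TG.
  exists (maxn i j) => //; split.
  - by move: a Fi; exact/subsetPset/ndF/leq_maxl.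
  - by move: v Gj; exact/subsetPset/ndG/leq_maxr.
move=> k; have [? ?] := Foo k; have [? ?] := Goo k; split.
  rewrite -[X in measurable X]setTI.
  by apply: measurable_rV_uncons => //; exact: measurableX.
rewrite /cons_measure /pushforward -comp_preimage.
rewrite (_ : _ \o _ = id) ?preimage_id; last exact/funext/rV_uncons_cons.
by rewrite product_measure1E// lte_mul_pinfty// ge0_fin_numE.
Qed.

HB.instance Definition _ :=
  Measure_isSigmaFinite.Build _ _ _ cons_measure cons_measure_sigma_finite.

End cons_measure.

Fixpoint lebesgue_rV m : {sigma_finite_measure set 'rV[R]_m -> \bar R} :=
  if m is m'.+1 then cons_measure (lebesgue_rV m') else \d_(0 : 'rV[R]_0).

End lebesgue_rV.

Definition dotv (R : realType) m (x y : 'rV[R]_m) : R :=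
  \sum_(i < m) x ord0 i * y ord0 i.

(* The norm `|_| of the library on matrices is the sup norm. *)
Definition normv (R : realType) m (x : 'rV[R]_m) : R := Num.sqrt (dotv x x).

Definition unitv (R : realType) m (x : 'rV[R]_m) : 'rV[R]_m :=
  (normv x)^-1 *: x.

Definition sphere (R : realType) (n : nat) : set 'rV[R]_n.+1 :=
  [set x | normv x = 1].

Section sphere_measure.
Variables (R : realType) (n : nat).
Local Notation E := 'rV[R]_n.+1.

Let cone_ball : set E := [set x | 0 < normv x <= 1].

Lemma measurable_normv m : measurable_fun setT (@normv R m).
Proof.
apply: measurableT_comp.
  by apply: continuous_measurable_fun; exact: sqrt_continuous.
by apply: measurable_sum => i; apply: measurable_funM; exact: measurable_coord.
Qed.

Lemma measurable_unitv m : measurable_fun setT (@unitv R m).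
Proof.
apply: measurable_rV => i; under eq_fun do rewrite mxE.
apply: measurable_funM; last exact: measurable_coord.
rewrite (_ : (fun _ => _) = (@powR R ^~ (-1)) \o @normv R m).
  exact: (measurableT_comp (@measurable_powR R (-1)) (@measurable_normv m)).
by apply/funext => x /=; rewrite powR_inv1// sqrtr_ge0.
Qed.

Lemma measurable_cone_ball : measurable cone_ball.
Proof.
rewrite -[cone_ball]setTI (_ : cone_ball = @normv R n.+1 @^-1` `]0, 1]).
  exact: measurable_normv.
by apply/seteqP; split => x; rewrite /= in_itv.
Qed.

(* Integration in polar coordinates: the standard volume of A, a subset of the
   unit sphere, is n + 1 times the Lebesgue measure of the solid cone
   { r x | 0 < r <= 1, x in A }. *)
Definition sphere_vol (A : set E) : \bar R :=
  (n.+1%:R%:E * lebesgue_rV R n.+1 (@unitv R n.+1 @^-1` A `&` cone_ball))%E.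

Let vol : {measure set E -> \bar R} :=
  mscale (n.+1%:R)%:nng (mrestr (lebesgue_rV R n.+1) measurable_cone_ball).

Let sphere_volE : sphere_vol = pushforward vol (@unitv R n.+1).
Proof. by []. Qed.

Let sphere_vol0 : sphere_vol set0 = 0%E.
Proof. by rewrite sphere_volE; apply: measure0; exact: measurable_unitv. Qed.

Let sphere_vol_ge0 A : (0 <= sphere_vol A)%E.
Proof. by rewrite sphere_volE; apply: measure_ge0; exact: measurable_unitv. Qed.

Let sphere_vol_sigma_additive : semi_sigma_additive sphere_vol.
Proof.
rewrite sphere_volE; apply: measure_semi_sigma_additive.
exact: measurable_unitv.
Qed.

HB.instance Definition _ := isMeasure.Build _ _ _ sphere_vol
  sphere_vol0 sphere_vol_ge0 sphere_vol_sigma_additive.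

End sphere_measure.

(* All iterated directional derivatives of f of order < k exist and are
   (Frechet) differentiable on U; for U open and all k this is C^infinity. *)
Fixpoint ndifferentiable (R : realType) (V W : normedModType R) (k : nat)
    (U : set V) (f : V -> W) : Prop :=
  if k is k'.+1 then
    (forall x, U x -> differentiable f x) /\
    (forall v, ndifferentiable k' U (fun x => 'D_v f x))
  else True.

(* The tangent space of the unit sphere at x is the orthogonal complement of x
   in R^n.+1, and the round metric is the restriction of dotv. Functions, forms
   and tensors on the sphere are represented by functions on R^n.+1, of which
   only the values on the sphere matter. A covector at x is represented by the
   tangent vector a x, its value at v being dotv (a x) v; a covariant 2-tensor
   is represented by a matrix A, its value at (v, w) being v *m A *m w^T, with
   tproj x *m A *m tproj x = A. *)
Section sphere_forms.
Variables (R : realType) (n : nat).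
Local Notation E := 'rV[R]_n.+1.
Local Notation form := (E -> E).
Local Notation tensor := (E -> 'M[R]_n.+1).
Local Notation S := (@sphere R n).
Local Notation dV := (@sphere_vol R n).

(* The extension of f from the sphere, constant along rays *)
Definition hom0 (T : Type) (f : E -> T) (x : E) : T := f (unitv x).

Definition smooth (f : E -> E) : Prop :=
  forall k, ndifferentiable k [set x : E | x != 0] (hom0 f).

Definition tangent (x v : E) : Prop := dotv x v = 0.

(* Orthogonal projection onto the tangent space *)
Definition tproj (x : E) : 'M[R]_n.+1 := 1%:M - x^T *m x.

Definition smooth_form (a : form) : Prop :=
  (forall x, S x -> tangent x (a x)) /\ smooth a.

(* Levi-Civita connection of a submanifold of R^n.+1: the tangential part of the
   ambient derivative. The (i, j) entry is (nabla_(e_i) a)(e_j), so that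
   v *m nabla a x is nabla_v a. *)
Definition nabla (a : form) : tensor := fun x =>
  tproj x *m 'J (hom0 a) x *m tproj x.

(* d a (v, w) = (nabla_v a)(w) - (nabla_w a)(v), in terms of A = nabla a *)
Definition extd (A : 'M[R]_n.+1) : 'M[R]_n.+1 := A - A^T.

Definition codiff (A : 'M[R]_n.+1) : R := - \tr A.

(* Volume form of the sphere at x (oriented by the outer normal) evaluated at
   the n vectors vs *)
Definition volume_form (x : E) (vs : seq E) : R :=
  \det (\matrix_(r < n.+1) nth (0 : E) (x :: vs) r).

Definition basis_vec (i : 'I_n.+1) : E := delta_mx 0 i.

(* Hodge star of the 2-form w at x, an (n - 2)-form, evaluated at vs *)
Definition hodge2 (x : E) (w : 'M[R]_n.+1) (vs : seq E) : R :=
  \sum_(i < n.+1) \sum_(j < n.+1 | (i < j)%N)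
    w i j * volume_form x (basis_vec i :: basis_vec j :: vs).

(* |b|^2 is the sum of the b(e_I)^2 over increasing I, i.e. 1/k! times the sum
   over all k-tuples I. As b vanishes in the normal direction, the basis of the
   ambient space can be used in place of one of the tangent space. *)
Definition norm_form (k : nat) (b : seq E -> R) : R :=
  Num.sqrt ((k`!)%:R^-1 *
    \sum_(s : k.-tuple 'I_n.+1) b [seq basis_vec i | i <- s] ^+ 2).

Definition norm_tensor (A : 'M[R]_n.+1) : R :=
  Num.sqrt (\sum_(i < n.+1) \sum_(j < n.+1) A i j ^+ 2).

(* A W^{1,p} form is given together with its weak covariant derivative, which
   it determines almost everywhere. *)
Definition jet : Type := (form * tensor)%type.

Definition smooth_jet (a : form) : jet := (a, nabla a).

Definition curl (u : jet) (x : E) : seq E -> R := hodge2 x (extd (u.2 x)).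

Definition sobolev_dist (p : R) (u v : jet) : \bar R :=
  ((\int[dV]_(x in S) (normv (u.1 x - v.1 x) `^ p
                       + norm_tensor (u.2 x - v.2 x) `^ p)%:E) `^ p^-1)%E.

(* W^{1,p} as the completion of the smooth forms for the norm
   (int |a|^p + |nabla a|^p)^(1/p): the closure in L^p x L^p of the pairs
   (a, nabla a) with a smooth. *)
Definition sobolev (p : R) (u : jet) : Prop :=
  [/\ forall i, measurable_fun S (fun x => u.1 x ord0 i),
      forall i j, measurable_fun S (fun x => u.2 x i j),
      forall x, S x -> tangent x (u.1 x),
      forall x, S x -> tproj x *m u.2 x *m tproj x = u.2 x &
      forall e : R, 0 < e -> exists a : form,
        smooth_form a /\ (sobolev_dist p u (smooth_jet a) < e%:E)%E].

Definition not_identically_zero (u : jet) : Prop :=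
  ~ {ae dV, forall x, S x -> u.1 x = 0}.

(* J_{n/2,1}; on W^{1,n/2} both integrals are finite, the second one by the
   Sobolev embedding into L^n. *)
Definition J (u : jet) : R :=
  (\int[dV]_(x in S) (norm_form n.-2 (curl u x) `^ (n%:R / 2))) ^+ 2
  / \int[dV]_(x in S) (normv (u.1 x) ^+ n).

Definition local_minimizer (u : jet) : Prop :=
  exists e : R, 0 < e /\
    forall v : jet, sobolev (n%:R / 2) v -> not_identically_zero v ->
      (sobolev_dist (n%:R / 2) v u < e%:E)%E -> J u <= J v.

Definition killing (a : form) : Prop :=
  [/\ smooth_form a,
      forall x, S x -> codiff (nabla a x) = 0 &
      forall x v, S x -> tangent x v ->
        v *m nabla a x = 2^-1 *: (v *m extd (nabla a x))].

Definition smooth_self_map (phi : E -> E) : Prop :=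
  (forall x, S x -> S (phi x)) /\ smooth phi.

(* v *m 'J (hom0 phi) x is the image of the tangent vector v at x under the
   differential of phi. *)
Definition conformal_diffeo (phi : E -> E) : Prop :=
  [/\ smooth_self_map phi,
      exists psi : E -> E, smooth_self_map psi /\
        forall x, S x -> psi (phi x) = x /\ phi (psi x) = x &
      forall x, S x -> exists l : R, 0 < l /\
        forall v w, tangent x v -> tangent x w ->
          dotv (v *m 'J (hom0 phi) x) (w *m 'J (hom0 phi) x)
          = l ^+ 2 * dotv v w].

(* (phi^* a)_x (v) = a_(phi x) (d phi_x v) *)
Definition pullback (phi : E -> E) (a : form) : form := fun x =>
  a (phi x) *m ('J (hom0 phi) x)^T.

Definition nonzero_killing (a : form) : Prop :=
  killing a /\ exists x, S x /\ a x != 0.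

Definition calM (a : form) : Prop :=
  nonzero_killing a \/
  exists (phi : E -> E) (b : form),
    [/\ conformal_diffeo phi, nonzero_killing b &
        forall x, S x -> a x = pullback phi b x].

End sphere_forms.

(* Main.v *)
Require Import Defs.
From mathcomp Require Import all_boot all_order all_algebra.
From mathcomp Require Import all_classical all_reals all_analysis.
From mathcomp Require Import measurable_realfun.
From mathcomp Require Import perm ring lra.

(** The differential of a form xi does not change when a nonzero exact form df is
added to it, while the denominator of J, the integral of |xi|^n, is strictly convex in
t along the line xi + t df. A strictly convex function of t has no local maximum
at t = 0, so the quotient has no local minimum there. Quantitatively, Clarkson's
inequality

  |a + b|^n + |a - b|^n >= 2 (|a|^n + |b|^n)

with a = xi and b = t df, integrated over the sphere, shows that the mean of the
denominators at xi + t df and xi - t df exceeds the one at xi by at least |t|^n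
times the integral of |df|^n (mass_clarkson). For every t <> 0 one of these two
forms thus has a strictly larger denominator, the same numerator (energyDZ), and
so a smaller quotient; its W^{1,n/2}-distance to xi is |t| times a constant
(sobolev_distDZ). The function f is taken linear, so that df is explicit
(dlinear).

The strict inequality between quotients requires a positive numerator: d xi must
not vanish identically on the sphere (calM_extd_neq0). Write xi as the pullback
of a nonzero Killing form b by a diffeomorphism phi. As d (phi^* b) = phi^* (d b)
(extd_pullback, which rests on the symmetry of second derivatives,
derive_commute), d xi = 0 would give d b = 0. A Killing form with d b = 0 is
parallel, and a parallel form on a sphere of dimension at least 2 vanishes,
because parallel transport around an octant is a rotation by a right angle
(parallel_eq0). Finally |* w| is positive for a nonzero 2-form w
(norm_form_hodge2_gt0), and the integral over the sphere of a nonnegative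
continuous function that is positive somewhere is positive
(Rintegral_sphere_gt0). *)

Set Implicit Arguments.
Unset Strict Implicit.
Unset Printing Implicit Defensive.

Import Order.TTheory GRing.Theory Num.Theory.
Import numFieldNormedType.Exports.
Local Open Scope classical_set_scope.
Local Open Scope ring_scope.

(** * Calculus of iterated directional derivatives *)

Section ndiff.
Variable R : realType.

Lemma near_eq_differentiable (V W : normedModType R) (f g : V -> W) (x : V) :
  {near x, f =1 g} -> differentiable f x -> differentiable g x.
Proof.
move=> fg df; have [dc /eqaddoP de] := (diff_locallyP _ _).1 df.
have fgx : f x = g x by exact: nbhs_singleton fg.
have H : g \o shift x = cst (g x) + 'd f x +o_ 0 id.
  apply/eqaddoP => e e0; have := de e e0; rewrite fgx => {}de.
  have fg0 : \forall y \near 0, f (y + x) = g (y + x).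
    by move: (fg); rewrite (near_shift 0)/= subr0.
  near=> y.
  have <- : (f \o shift x - (cst (g x) + 'd f x)) y = (g \o shift x - (cst (g x) + 'd f x)) y.
    by rewrite !fctE/=; congr (_ - _); near: y.
  by near: y.
have dg : 'd g x = 'd f x :> (V -> W) by apply: diff_unique.
by apply/diff_locallyP; rewrite dg.
Unshelve. all: by end_near. Qed.

Lemma differentiable_rV (V : normedModType R) m (f : V -> 'rV[R]_m) (x : V) :
  (forall j, differentiable (fun y => f y ord0 j) x) -> differentiable f x.
Proof.
move=> df; have -> : f = \sum_(j < m) (fun y => f y ord0 j *: (delta_mx 0 j : 'rV[R]_m)).
  by apply/funext => y; rewrite fct_sumE {1}[f y]row_sum_delta.
by apply: differentiable_sum => j; exact: differentiableZl.
Qed.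

Lemma differentiable_rVP (V : normedModType R) m (f : V -> 'rV[R]_m) (x : V) :
  differentiable f x <-> forall j, differentiable (fun y => f y ord0 j) x.
Proof.
split; last exact: differentiable_rV.
move=> df j.
exact: (@differentiable_comp _ _ _ _ f (fun N : 'rV_m => N ord0 j : R) x df
  (differentiable_coord _ _ _)).
Qed.

Lemma derive_coord (V : normedModType R) m (f : V -> 'rV[R]_m) (x v : V) j :
  differentiable f x -> ('D_v f x) ord0 j = 'D_v (fun y => f y ord0 j) x.
Proof. by move=> df; rewrite derive_mx ?mxE//; exact: diff_derivable. Qed.

(** The chain rule with the outer derivative expanded along the coordinates: the
right-hand side is built from functions of a fixed direction, which is what the
induction defining [ndifferentiable] can be applied to. *)
Lemma derive_comp_sum (V : normedModType R) m (g : V -> 'rV[R]_m)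
    (f : 'rV[R]_m -> R) (x v : V) :
  differentiable g x -> differentiable f (g x) ->
  'D_v (f \o g) x =
  \sum_(j < m) 'D_v (fun y => g y ord0 j) x * 'D_(delta_mx 0 j) f (g x).
Proof.
move=> dg df; rewrite deriveE; last exact: differentiable_comp.
rewrite diff_comp//= -[X in 'd f (g x) X]deriveE// {1}['D_v g x]row_sum_delta linear_sum.
by apply: eq_bigr => j _; rewrite linearZ/= -deriveE// derive_coord.
Qed.

(** [U] is open, so that agreement on [U] carries over to the derivatives at the
points of [U]; outside of [U] nothing is known about them. *)
Lemma ndifferentiable_ext (V W : normedModType R) k (U : set V) (f g : V -> W) :
  open U -> (forall x, U x -> f x = g x) ->
  ndifferentiable k U f -> ndifferentiable k U g.
Proof.
move=> oU; elim: k f g => [//|k IH] f g fg [df Df].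
have nfg x : U x -> {near x, f =1 g}.
  by move=> Ux; apply: filterS (open_nbhs_nbhs (conj oU Ux)).
split=> [x Ux|v]; first exact: (near_eq_differentiable (nfg x Ux) (df x Ux)).
by apply: IH (Df v) => x Ux; apply: near_eq_derive; exact: nfg.
Qed.

Lemma ndifferentiableW (V W : normedModType R) k (U : set V) (f : V -> W) :
  ndifferentiable k.+1 U f -> ndifferentiable k U f.
Proof.
elim: k f => [//|k IH] f [df Df].
by split=> // v; exact/IH/Df.
Qed.

Lemma ndifferentiable_cst (V W : normedModType R) k (U : set V) (w : W) :
  ndifferentiable k U (cst w : V -> W).
Proof.
elim: k w => [//|k IH] w; split=> [x _|v]; first exact: differentiable_cst.
rewrite (_ : (fun x => _) = cst 0); first exact: IH.
by apply/funext => x; rewrite derive_cst.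
Qed.

Lemma ndifferentiableD (V W : normedModType R) k (U : set V) (f g : V -> W) :
  open U -> ndifferentiable k U f -> ndifferentiable k U g ->
  ndifferentiable k U (fun x => f x + g x).
Proof.
move=> oU; elim: k f g => [//|k IH] f g [df Df] [dg Dg].
split=> [x Ux|v]; first exact: (differentiableD (df x Ux) (dg x Ux)).
apply: (@ndifferentiable_ext _ _ _ _ (fun x => 'D_v f x + 'D_v g x)) => //.
  by move=> x Ux; rewrite -deriveD//; apply: diff_derivable; [exact: df|exact: dg].
by apply: IH; [exact: Df|exact: Dg].
Qed.

Lemma ndifferentiable_sum (V W : normedModType R) k (U : set V) (I : Type)
    (r : seq I) (f : I -> V -> W) :
  open U -> (forall i, ndifferentiable k U (f i)) ->
  ndifferentiable k U (fun x => \sum_(i <- r) f i x).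
Proof.
move=> oU df; elim: r => [|i r IH].
  by under eq_fun do rewrite big_nil; exact: ndifferentiable_cst.
by under eq_fun do rewrite big_cons; exact: ndifferentiableD.
Qed.

Lemma ndifferentiableM (V : normedModType R) k (U : set V) (f g : V -> R) :
  open U -> ndifferentiable k U f -> ndifferentiable k U g ->
  ndifferentiable k U (fun x => f x * g x).
Proof.
move=> oU; elim: k f g => [//|k IH] f g nf ng.
have [df Df] := nf; have [dg Dg] := ng.
split=> [x Ux|v]; first exact: (differentiableM (df x Ux) (dg x Ux)).
apply: (@ndifferentiable_ext _ _ _ _ (fun x => f x * 'D_v g x + g x * 'D_v f x)) => //.
  by move=> x Ux; rewrite -deriveM//; apply: diff_derivable; [exact: df|exact: dg].
apply: ndifferentiableD => //; apply: IH => //; try exact: ndifferentiableW.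
  exact: Dg.
exact: Df.
Qed.

Lemma ndifferentiable_rVP (V : normedModType R) m k (U : set V) (f : V -> 'rV[R]_m) :
  open U ->
  ndifferentiable k U f <-> forall j, ndifferentiable k U (fun x => f x ord0 j).
Proof.
move=> oU; elim: k f => [//|k IH] f; split=> [[df Df] j|ndf].
  split=> [x Ux|v]; first exact: (differentiable_rVP _ _).1 (df x Ux) j.
  apply: ndifferentiable_ext ((IH _).1 (Df v) j) => // x Ux.
  by rewrite derive_coord//; exact: df.
have df x : U x -> differentiable f x.
  by move=> Ux; apply/differentiable_rVP => j; exact: (ndf j).1.
split=> // v; apply/IH => j; apply: ndifferentiable_ext ((ndf j).2 v) => // x Ux.
by rewrite derive_coord//; exact: df.
Qed.

(** By the chain rule the derivatives of a composite are sums of products of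
derivatives of [g] with composites of derivatives of [f], of one order less. *)
Lemma ndifferentiable_comp (V : normedModType R) m k (U : set V)
    (U' : set 'rV[R]_m) (g : V -> 'rV[R]_m) (f : 'rV[R]_m -> R) :
  open U -> (forall x, U x -> U' (g x)) ->
  ndifferentiable k U g -> ndifferentiable k U' f ->
  ndifferentiable k U (f \o g).
Proof.
move=> oU gU; elim: k f => [//|k IH] f ng nf.
have [dg Dg] := ng; have [df Df] := nf.
split=> [x Ux|v]; first exact: (differentiable_comp (dg x Ux) (df _ (gU x Ux))).
apply: (@ndifferentiable_ext _ _ _ _ (fun x =>
    \sum_(j < m) 'D_v (fun y => g y ord0 j) x * 'D_(delta_mx 0 j) f (g x))) => //.
  by move=> x Ux; rewrite derive_comp_sum//; [exact: dg|exact/df/gU].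
apply: ndifferentiable_sum => // j; apply: ndifferentiableM => //.
  have /(_ j)[_] := (ndifferentiable_rVP _ _ oU).1 ng; exact.
by apply: (IH ('D_(delta_mx 0 j) f)); [exact: ndifferentiableW|exact: Df].
Qed.

Lemma ndifferentiable_coord m k (U : set 'rV[R]_m) j :
  ndifferentiable k U (fun x : 'rV[R]_m => x ord0 j).
Proof.
case: k => [//|k]; split=> [x _|v]; first exact: differentiable_coord.
rewrite (_ : (fun x => _) = cst (v ord0 j)); first exact: ndifferentiable_cst.
by apply/funext => x; rewrite -(@derive_coord _ _ id)// derive_id.
Qed.

End ndiff.
(** * The Euclidean structure and the radial projection *)

Section euclid.
Variable R : realType.
Variable m : nat.
Implicit Types x y z v : 'rV[R]_m.

Lemma dotvE x y : dotv x y = (x *m y^T) ord0 ord0.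
Proof. by rewrite mxE; apply: eq_bigr => i _; rewrite mxE. Qed.

Lemma dotvC x y : dotv x y = dotv y x.
Proof. by apply: eq_bigr => i _; rewrite mulrC. Qed.

Lemma dotvDl x y z : dotv (x + y) z = dotv x z + dotv y z.
Proof. by rewrite !dotvE mulmxDl mxE. Qed.

Lemma dotvZl a x z : dotv (a *: x) z = a * dotv x z.
Proof. by rewrite !dotvE -scalemxAl mxE. Qed.

Lemma dotvNl x z : dotv (- x) z = - dotv x z.
Proof. by rewrite -scaleN1r dotvZl mulN1r. Qed.

Lemma dotvDr x y z : dotv z (x + y) = dotv z x + dotv z y.
Proof. by rewrite !(dotvC z) dotvDl. Qed.

Lemma dotvZr a x z : dotv z (a *: x) = a * dotv z x.
Proof. by rewrite !(dotvC z) dotvZl. Qed.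

Lemma dotvNr x z : dotv z (- x) = - dotv z x.
Proof. by rewrite !(dotvC z) dotvNl. Qed.

Lemma dotv0l z : dotv 0 z = 0.
Proof. by rewrite -(scale0r 0) dotvZl mul0r. Qed.

Lemma dotv0r z : dotv z 0 = 0.
Proof. by rewrite dotvC dotv0l. Qed.

Lemma dotv_ge0 x : 0 <= dotv x x.
Proof. by apply: sumr_ge0 => i _; rewrite -expr2 sqr_ge0. Qed.

Lemma dotv_eq0 x : (dotv x x == 0) = (x == 0).
Proof.
apply/idP/eqP => [|->]; last by rewrite dotv0l.
rewrite psumr_eq0 => [/allP H|i _]; last by rewrite -expr2 sqr_ge0.
apply/rowP => i; rewrite mxE; apply/eqP.
by have := H i (mem_index_enum _); rewrite -expr2 sqrf_eq0.
Qed.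

Lemma dotv_delta x j : dotv x (delta_mx 0 j) = x ord0 j.
Proof.
rewrite /dotv (bigD1 j)//= mxE !eqxx mulr1 big1 ?addr0// => i ij.
by rewrite mxE (negbTE ij) andbF mulr0.
Qed.

Lemma normv_ge0 x : 0 <= normv x.
Proof. exact: sqrtr_ge0. Qed.

Lemma sqr_normv x : normv x ^+ 2 = dotv x x.
Proof. by rewrite sqr_sqrtr// dotv_ge0. Qed.

Lemma normv_eq0 x : (normv x == 0) = (x == 0).
Proof. by rewrite -sqrf_eq0 sqr_normv dotv_eq0. Qed.

Lemma normv_gt0 x : (0 < normv x) = (x != 0).
Proof. by rewrite lt_def normv_ge0 andbT normv_eq0. Qed.

Lemma normvZ a x : normv (a *: x) = `|a| * normv x.
Proof.
by rewrite /normv dotvZl dotvZr mulrA -expr2 sqrtrM ?sqr_ge0// sqrtr_sqr.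
Qed.

Lemma unitvZ a x : 0 < a -> unitv (a *: x) = unitv x.
Proof.
move=> a0; rewrite /unitv normvZ gtr0_norm// scalerA invfM.
by rewrite mulrAC mulVf ?gt_eqF// mul1r.
Qed.

Lemma normv_unitv x : x != 0 -> normv (unitv x) = 1.
Proof.
move=> x0; rewrite normvZ ger0_norm ?invr_ge0 ?normv_ge0//.
by rewrite mulVf// normv_eq0.
Qed.

Lemma unitv_id x : normv x = 1 -> unitv x = x.
Proof. by move=> x1; rewrite /unitv x1 invr1 scale1r. Qed.

Lemma normv1_neq0 x : normv x = 1 -> x != 0.
Proof. by move=> x1; rewrite -normv_gt0 x1. Qed.

Lemma unitv_neq0 x : x != 0 -> unitv x != 0.
Proof. by move=> x0; apply/normv1_neq0/normv_unitv. Qed.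

Lemma dotv1 x : normv x = 1 -> dotv x x = 1.
Proof. by move=> x1; rewrite -sqr_normv x1 expr1n. Qed.

Lemma open_neq0 : open [set x : 'rV[R]_m | x != 0].
Proof.
rewrite (_ : mkset _ = ~` [set 0]); last by apply/seteqP; split=> x /= /eqP.
apply: closed_openC; apply: accessible_closed_set1.
by apply: hausdorff_accessible; exact: norm_hausdorff.
Qed.

End euclid.

Lemma hom0_sphere (R : realType) n T (f : 'rV[R]_n.+1 -> T) x : normv x = 1 -> hom0 f x = f x.
Proof. by move=> x1; rewrite /hom0 unitv_id. Qed.

Section unitv_smooth.
Variables (R : realType) (m : nat).
Local Notation E := 'rV[R]_m.
Local Notation nz := [set x : E | x != 0].

Lemma differentiable_dotv (x : E) : differentiable (fun x : E => dotv x x) x.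
Proof.
rewrite /dotv (_ : (fun x => _) = \sum_(i < m) (fun x : E => x ord0 i * x ord0 i)); last first.
  by apply/funext => y; rewrite fct_sumE.
apply: differentiable_sum => i.
by apply: differentiableM; exact: differentiable_coord.
Qed.

Lemma derive_dotv (x v : E) : 'D_v (fun x : E => dotv x x) x = 2 * dotv x v.
Proof.
rewrite /dotv (_ : (fun x => _) = \sum_(i < m) (fun x : E => x ord0 i * x ord0 i)); last first.
  by apply/funext => y; rewrite fct_sumE.
have dc i : derivable (fun y : E => y ord0 i) x v.
  by apply: diff_derivable; exact: differentiable_coord.
rewrite derive_sum; last by move=> i; exact: derivableM.
rewrite mulr_sumr; apply: eq_bigr => i _.
rewrite deriveM// -(@derive_coord _ _ _ id)// derive_id.
by rewrite /GRing.scale/= mulr_natl mulr2n.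
Qed.

Lemma differentiable_normv (x : E) : x != 0 -> differentiable (@normv R m) x.
Proof.
move=> x0; apply: (@differentiable_comp _ _ _ _ (fun x : E => dotv x x) Num.sqrt).
  exact: differentiable_dotv.
apply/derivable1_diffP.
have := @is_derive1_sqrt R (dotv x x); case; last by [].
by rewrite lt_def dotv_eq0 x0 dotv_ge0.
Qed.

Lemma derive_normv (x v : E) : x != 0 ->
  'D_v (@normv R m) x = (normv x)^-1 * dotv x v.
Proof.
move=> x0; have dn := diff_derivable (v := v) (differentiable_normv x0).
have sq : (fun x : E => dotv x x) = @normv R m * @normv R m :> (E -> R).
  by apply/funext => y; rewrite -sqr_normv expr2.
have := congr1 (fun f : E -> R => 'D_v f x) sq.
rewrite derive_dotv deriveM// /GRing.scale/= -mulr2n => H.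
have n0 : normv x != 0 by rewrite normv_eq0.
have {}H : dotv x v = normv x * 'D_v (@normv R m) x.
  by apply: (@mulfI _ (2 : R)); [rewrite pnatr_eq0|rewrite H mulr_natl].

by rewrite H mulKf.
Qed.

Lemma ndifferentiable_dotv k (U : set E) v :
  open U -> ndifferentiable k U (fun x => dotv x v).
Proof.
move=> oU; apply: ndifferentiable_sum => // i; apply: ndifferentiableM => //.
  exact: ndifferentiable_coord.
exact: ndifferentiable_cst.
Qed.

(** The derivative of 1 / |x| in direction v is - <x, v> / |x|^3, a polynomial in
1 / |x| and linear functions, which makes an induction on the order possible. *)
Lemma ndifferentiable_invnormv k : ndifferentiable k nz (fun x => (normv x)^-1).
Proof.
have onz := @open_neq0 R m.
elim: k => [//|k IH]; split=> [x x0|v].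
  by apply: differentiableV; [exact: differentiable_normv|rewrite normv_eq0].
apply: (@ndifferentiable_ext _ _ _ _ _ (fun x =>
    -1 * ((normv x)^-1 * (normv x)^-1 * (normv x)^-1) * dotv x v)) => //.
  move=> x x0; rewrite deriveV ?normv_eq0//.
    by rewrite derive_normv// /GRing.scale/= -exprVn expr2 mulN1r mulNr mulrA !mulNr.
  by apply: diff_derivable; exact: differentiable_normv.
apply: ndifferentiableM => //; last exact: ndifferentiable_dotv.
apply: ndifferentiableM => //; first exact: (@ndifferentiable_cst _ _ R^o).
by apply: ndifferentiableM => //; exact: ndifferentiableM.
Qed.

Lemma ndifferentiable_unitv k : ndifferentiable k nz (@unitv R m).
Proof.
have onz := @open_neq0 R m.
apply/ndifferentiable_rVP => // j.
rewrite (_ : (fun _ => _) = (fun x : E => (normv x)^-1 * x ord0 j)); last first.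
  by apply/funext => x; rewrite mxE.
apply: ndifferentiableM => //; first exact: ndifferentiable_invnormv.
exact: ndifferentiable_coord.
Qed.

Lemma differentiable_unitv (x : E) : x != 0 -> differentiable (@unitv R m) x.
Proof. by move=> x0; have [/(_ x x0)] := ndifferentiable_unitv 1. Qed.

Lemma derive_unitv (x v : E) : normv x = 1 -> dotv x v = 0 ->
  'D_v (@unitv R m) x = v.
Proof.
move=> x1 xv; have x0 := normv1_neq0 x1.
apply/rowP => j; rewrite derive_coord; last exact: differentiable_unitv.
rewrite /unitv; under eq_fun do rewrite mxE.
have dn := diff_derivable (v := v) (differentiable_normv x0).
have dc : derivable (fun y : E => y ord0 j) x v.
  by apply: diff_derivable; exact: differentiable_coord.
have nx0 : normv x != 0 by rewrite normv_eq0.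
have Dinv : 'D_v (fun y : E => (normv y)^-1) x = 0.
  by apply: etrans (deriveV nx0 dn) _; rewrite derive_normv// xv mulr0 scaler0.
have Dcoord : 'D_v (fun y : E => y ord0 j) x = v ord0 j.
  by rewrite -(@derive_coord _ _ _ id)// derive_id.
apply: etrans (deriveM (derivableV nx0 dn) dc) _.
by rewrite Dinv Dcoord scaler0 addr0 x1 invr1 scale1r.
Qed.

End unitv_smooth.
(** * Symmetry of second derivatives *)

Section schwarz.
Variable R : realType.

Lemma is_derive_curve (V W : normedModType R) (f : V -> W) (g : R -> V) (s : R) v :
  differentiable f (g s) -> is_derive s 1 g v ->
  is_derive s 1 (f \o g) ('D_v f (g s)).
Proof.
move=> df [dg <-]; have {}dg := (derivable1_diffP _ _).1 dg.
apply: DeriveDef.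
  by apply: diff_derivable; exact: differentiable_comp.
rewrite deriveE; last exact: differentiable_comp.
by rewrite diff_comp//= -[X in 'd f (g s) X]deriveE// -deriveE.
Qed.

Lemma derive_comp_shift (V W : normedModType R) (f : V -> W) (c x v : V) :
  'D_v (f \o shift c) x = 'D_v f (x + c).
Proof.
rewrite /derive.
have -> : (fun h : R => h^-1 *: (((f \o shift c) \o shift x) (h *: v) - (f \o shift c) x)) =
    (fun h : R => h^-1 *: ((f \o shift (x + c)) (h *: v) - f (x + c))); last by [].
by apply/funext => h /=; rewrite addrA.
Qed.

Lemma is_derive_line (V : normedModType R) (x v : V) (s : R) :
  is_derive s 1 (fun s : R => x + s *: v) v.
Proof.
have dv : is_derive s 1 ( *:%R ^~ v : R -> V) v.
  apply: DeriveDef; first exact: diff_derivable.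
  by rewrite deriveE// diff_val/= scale1r.
rewrite -[v in X in is_derive _ _ _ X]add0r.
exact: (is_deriveD (f := cst x)).
Qed.

Lemma MVT_line (V : normedModType R) (f : V -> R) (x v : V) (h : R) : 0 < h ->
  (forall s, 0 <= s <= h -> differentiable f (x + s *: v)) ->
  exists2 s, 0 <= s <= h & f (x + h *: v) - f x = h * 'D_v f (x + s *: v).
Proof.
move=> h0 df.
have dl s : 0 <= s <= h ->
    is_derive s 1 (f \o (fun s : R => x + s *: v)) ('D_v f (x + s *: v)).
  by move=> sh; apply: is_derive_curve; [exact: df|exact: is_derive_line].
have [||s] := @MVT R (f \o (fun s : R => x + s *: v))
    (fun s => 'D_v f (x + s *: v)) 0 h h0.
- by move=> s; rewrite in_itv/= => /andP[s0 sh]; apply: dl; rewrite !ltW.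
- apply: derivable_within_continuous => s; rewrite in_itv/= => sh.
  exact: (@ex_derive _ _ _ _ _ _ _ (dl s sh)).
rewrite in_itv/= subr0 scale0r addr0 => /andP[s0 sh] E.
by exists s; [rewrite !ltW|rewrite mulrC].
Qed.

(** The mean value theorem is applied to y |-> f (y + h w) - f y in direction v,
and then to the derivative of f along v in direction w. *)
Lemma second_difference (V : normedModType R) (f : V -> R) (x v w : V) (h : R)
    (U : set V) : 0 < h -> ndifferentiable 2 U f ->
  (forall s t : R, 0 <= s <= h -> 0 <= t <= h -> U (x + s *: v + t *: w)) ->
  exists s t, [/\ 0 <= s <= h, 0 <= t <= h &
    f (x + h *: v + h *: w) - f (x + h *: w) - (f (x + h *: v) - f x) =
    h ^+ 2 * 'D_w (fun y => 'D_v f y) (x + s *: v + t *: w)].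
Proof.
move=> h0 [df Df] Uh.
have hh : 0 <= h <= h by rewrite lexx ltW.
have h00 : (0:R) <= 0 <= h by rewrite lexx ltW.
pose g := (f \o shift (h *: w)) - f.
have dsh y : differentiable (shift (h *: w) : V -> V) y.
  exact: differentiableD.
have dg s : 0 <= s <= h -> differentiable g (x + s *: v).
  move=> sh; apply: differentiableB.
    by apply: differentiable_comp => //; exact/df/Uh.
  by apply: df; have := Uh s 0 sh h00; rewrite scale0r addr0.
have [s sh Es] := MVT_line h0 dg.
have [t th Et] : exists2 t, 0 <= t <= h &
    'D_v f (x + s *: v + h *: w) - 'D_v f (x + s *: v) =
    h * 'D_w (fun y => 'D_v f y) (x + s *: v + t *: w).
  by apply: (@MVT_line _ ('D_v f)) => // t th; exact/(Df v).1/Uh.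
exists s, t; split => //.
transitivity (g (x + h *: v) - g x).
  by rewrite /g /= -!fctE/= !fctE/=; ring.
rewrite Es expr2 -mulrA; congr (_ * _); rewrite -Et /g.
have dfs : differentiable f (x + s *: v).
  by apply: df; have := Uh s 0 sh h00; rewrite scale0r addr0.
have dfsh : differentiable f (x + s *: v + h *: w) by exact/df/Uh.
rewrite deriveB; last 2 first.
- by apply: diff_derivable; apply: differentiable_comp => //; exact: dfsh.
- exact: diff_derivable.
congr (_ - _).
exact: derive_comp_shift.
Qed.

(** The second difference is symmetric in v and w up to rearrangement, so it is h^2
times either mixed derivative, each at some point near x; both are continuous at
x, and h is arbitrarily small. *)
Lemma derive_commute (V : normedModType R) (f : V -> R) (x v w : V)
    (U : set V) : open U -> U x -> ndifferentiable 3 U f ->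
  'D_w (fun y => 'D_v f y) x = 'D_v (fun y => 'D_w f y) x.
Proof.
move=> oU Ux nf; have [_ Df] := nf.
have nf2 := ndifferentiableW nf.
have cwv : {for x, continuous (fun y => 'D_w (fun y => 'D_v f y) y)}.
  by apply: differentiable_continuous; have [_ /(_ w)[+ _]] := Df v; exact.
have cvw : {for x, continuous (fun y => 'D_v (fun y => 'D_w f y) y)}.
  by apply: differentiable_continuous; have [_ /(_ v)[+ _]] := Df w; exact.
apply/eqP; rewrite -subr_eq0 -normr_le0; apply/ler_addgt0Pl => e e0.
rewrite addr0.
have e20 : 0 < e / 2 by rewrite divr_gt0.
have n1 : \forall y \near x,
    `|'D_w (fun y => 'D_v f y) x - 'D_w (fun y => 'D_v f y) y| < e / 2.
  exact: ((cvgrPdist_lt _ _).1 cwv _ e20).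
have n2 : \forall y \near x,
    `|'D_v (fun y => 'D_w f y) x - 'D_v (fun y => 'D_w f y) y| < e / 2.
  exact: ((cvgrPdist_lt _ _).1 cvw _ e20).
have : \forall y \near x, [/\ U y,
   `|'D_w (fun y => 'D_v f y) x - 'D_w (fun y => 'D_v f y) y| < e / 2 &
   `|'D_v (fun y => 'D_w f y) x - 'D_v (fun y => 'D_w f y) y| < e / 2].
  have n0 := open_nbhs_nbhs (conj oU Ux).
  by move: n0 n1 n2; apply: filterS3 => y ? ? ?; split.
move=> /nbhs_ballP[r /= r0 xr].
pose h := r / 2 / (`|v| + `|w| + 1).
have d0 : 0 < `|v| + `|w| + 1 by rewrite ltr_wpDl// addr_ge0.
have h0 : 0 < h by rewrite /h !divr_gt0.
have bh s t : 0 <= s <= h -> 0 <= t <= h -> ball x r (x + s *: v + t *: w).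
  move=> /andP[s0 sh] /andP[t0 th].
  rewrite -ball_normE /ball_/= -addrA opprD addrA subrr sub0r normrN.
  rewrite (le_lt_trans (ler_normD _ _))// !normrZ !ger0_norm//.
  have : s * `|v| + t * `|w| <= h * (`|v| + `|w| + 1).
    rewrite !mulrDr mulr1 ler_wpDr// ?(ltW h0)//.
    by rewrite lerD// ler_wpM2r.
  move=> /le_lt_trans; apply; rewrite /h mulfVK ?gt_eqF//.
  by rewrite ltr_pdivrMr// ltr_pMr// ltr1n.
have [s [t [sh th E1]]] := second_difference h0 nf2 (fun s t sh th =>
  let: And3 u _ _ := xr _ (bh s t sh th) in u).
have bh' s' t' : 0 <= s' <= h -> 0 <= t' <= h -> ball x r (x + s' *: w + t' *: v).
  by move=> ? ?; rewrite addrAC; exact: bh.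
have [s' [t' [sh' th' E2]]] := second_difference h0 nf2 (fun s t sh th =>
  let: And3 u _ _ := xr _ (bh' s t sh th) in u).
have E : 'D_w (fun y => 'D_v f y) (x + s *: v + t *: w) =
         'D_v (fun y => 'D_w f y) (x + s' *: w + t' *: v).
  apply: (@mulfI _ (h ^+ 2)); first by rewrite expf_neq0// gt_eqF.
  have aux (k l q z : R) : k - l - (q - z) = k - q - (l - z) by ring.
  apply: etrans (esym E1) _; apply: etrans _ E2.
  by rewrite (addrAC x (h *: w)); exact: aux.
have [_ + _] := xr _ (bh _ _ sh th); have [_ _] := xr _ (bh' _ _ sh' th').
rewrite -E => H2 H1; rewrite (splitr e).
apply: le_trans (ltW (ltrD H1 H2)).
by rewrite -[X in _ <= _ + X]normrN; apply: le_trans (ler_normD _ _); rewrite opprB subrKA.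
Unshelve. all: by end_near. Qed.

End schwarz.
Section derive_rV.
Variable R : realType.

Lemma derive_comp (U V W : normedModType R) (g : U -> V) (f : V -> W) (x v : U) :
  differentiable g x -> differentiable f (g x) ->
  'D_v (f \o g) x = 'D_('D_v g x) f (g x).
Proof.
move=> dg df; rewrite (deriveE v (differentiable_comp dg df)) (diff_comp dg df).
by rewrite (deriveE _ df) (deriveE v dg).
Qed.

Lemma derive_locally_cst (V W : normedModType R) (f : V -> W) (c : W) (U : set V)
    (x v : V) :
  open U -> U x -> (forall y, U y -> f y = c) -> 'D_v f x = 0.
Proof.
move=> oU Ux fc; rewrite -[RHS](derive_cst c x v); apply: near_eq_derive.
by apply: filterS (open_nbhs_nbhs (conj oU Ux)) => y /fc.
Qed.

Lemma derive_dotv2 (V : normedModType R) m (f g : V -> 'rV[R]_m) (x v : V) :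
  differentiable f x -> differentiable g x ->
  'D_v (fun y => dotv (f y) (g y)) x = dotv ('D_v f x) (g x) + dotv (f x) ('D_v g x).
Proof.
move=> df dg.
have dfi i : derivable (fun y => f y ord0 i) x v.
  by apply: diff_derivable; exact: (differentiable_rVP _ _).1 df i.
have dgi i : derivable (fun y => g y ord0 i) x v.
  by apply: diff_derivable; exact: (differentiable_rVP _ _).1 dg i.
rewrite /dotv (_ : (fun y => _) =
    \sum_(i < m) (fun y => f y ord0 i) * (fun y => g y ord0 i)); last first.
  by apply/funext => y; rewrite fct_sumE.
rewrite derive_sum; last by move=> i; exact: derivableM.
rewrite -big_split/=; apply: eq_bigr => i _.
rewrite (deriveM (dfi i) (dgi i)) (derive_coord v i df) (derive_coord v i dg).
by rewrite [LHS]addrC; congr (_ + _); exact: mulrC.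
Qed.

Lemma derive_commute_rV (V : normedModType R) m (f : V -> 'rV[R]_m) (x v w : V)
    (U : set V) : open U -> U x -> ndifferentiable 3 U f ->
  'D_w (fun y => 'D_v f y) x = 'D_v (fun y => 'D_w f y) x.
Proof.
move=> oU Ux nf; have nfx := nbhs_singleton (open_nbhs_nbhs (conj oU Ux)).
have df y : U y -> differentiable f y by move=> Uy; exact: nf.1.
have dDf z : differentiable ('D_z f) x by exact: (nf.2 z).1.
apply/rowP => j.
have Ev := derive_coord w j (dDf v).
have Ew := derive_coord v j (dDf w).
apply: etrans Ev _; apply: etrans (esym Ew).
have E z z' : 'D_z (fun y => ('D_z' f y) ord0 j) x =
    'D_z (fun y => 'D_z' (fun t => f t ord0 j) y) x.
  apply: near_eq_derive; apply: filterS (open_nbhs_nbhs (conj oU Ux)) => y Uy.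
  by rewrite (derive_coord z' j (df y Uy)).
have nfj := (ndifferentiable_rVP _ _ oU).1 nf j.
apply: etrans (E w v) _; apply: etrans (esym (E v w)).
exact: (derive_commute v w oU Ux nfj).
Qed.

Lemma is_derive_scalel (W : normedModType R) (k : R -> R) (w : W) (s dk : R) :
  is_derive s 1 k dk -> is_derive s 1 (fun s => k s *: w) (dk *: w).
Proof.
move=> dks; have dw : differentiable ( *:%R ^~ w : R -> W) (k s) by [].
apply: is_derive_eq (is_derive_curve dw dks) _.
by rewrite deriveE// diff_val.
Qed.

Lemma is_derive_circle m (p q : 'rV[R]_m) (s : R) :
  is_derive s 1 (fun s : R => cos s *: p + sin s *: q) (- sin s *: p + cos s *: q).
Proof.
apply: (is_deriveD (f := fun s => cos s *: p) (g := fun s => sin s *: q));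
  exact: is_derive_scalel.
Qed.

Lemma is_derive_dotv m (f g : R -> 'rV[R]_m) (s : R) (df dg : 'rV[R]_m) :
  is_derive s 1 f df -> is_derive s 1 g dg ->
  is_derive s 1 (fun s => dotv (f s) (g s)) (dotv df (g s) + dotv (f s) dg).
Proof.
move=> [/derivable1_diffP df1 <-] [/derivable1_diffP dg1 <-].
rewrite -derive_dotv2//; apply: derivableP; apply: diff_derivable.
rewrite /dotv (_ : (fun y => _) =
    \sum_(i < m) (fun y => f y ord0 i) * (fun y => g y ord0 i)); last first.
  by apply/funext => y; rewrite fct_sumE.
apply: differentiable_sum => i; apply: differentiableM.
  exact: (differentiable_rVP _ _).1 df1 i.
exact: (differentiable_rVP _ _).1 dg1 i.
Qed.

End derive_rV.

(** * Smooth forms on the sphere and their pullbacks *)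

Section sphere_calculus.
Variables (R : realType) (n : nat).
Local Notation E := 'rV[R]_n.+1.
Local Notation S := (@sphere R n).
Local Notation nz := [set x : E | x != 0].
Implicit Types (a b phi psi : E -> E) (x y v w : E).

Let onz := @open_neq0 R n.+1.

Lemma smooth_differentiable a x : smooth a -> x != 0 -> differentiable (hom0 a) x.
Proof. by move=> /(_ 1) [+ _]; exact. Qed.

Lemma smooth_derive_differentiable a x v : smooth a -> x != 0 ->
  differentiable (fun y => 'D_v (hom0 a) y) x.
Proof. by move=> /(_ 2) [_ /(_ v)[+ _]]; exact. Qed.

Lemma mul_tproj x v : tangent x v -> v *m tproj x = v.
Proof.
move=> xv; rewrite mulmxBr mulmx1 mulmxA.
have -> : v *m x^T = 0.
  apply/matrixP => i j; rewrite !ord1 [in RHS]mxE -[RHS]xv [in RHS]dotvC.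
  by rewrite [in RHS]dotvE.
by rewrite mul0mx subr0.
Qed.

Lemma tproj_sym x : (tproj x)^T = tproj x.
Proof. by rewrite /tproj linearB/= trmx1 trmx_mul trmxK. Qed.

Lemma nablaE a x v w : S x -> smooth a -> tangent x v -> tangent x w ->
  (v *m nabla a x *m w^T) ord0 ord0 = dotv ('D_v (hom0 a) x) w.
Proof.
move=> Sx sa xv xw; have x0 := normv1_neq0 Sx.
have Ew : tproj x *m w^T = w^T by rewrite -tproj_sym -trmx_mul mul_tproj.
rewrite /nabla !mulmxA (mul_tproj xv) -(mulmxA _ (tproj x)) Ew.
by rewrite -deriveEjacobian ?dotvE//; exact: smooth_differentiable.
Qed.

(** On tangent vectors, d a is the antisymmetrized ambient derivative of the radial
extension of a: the projections in [nabla] act trivially. *)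
Lemma extdE a x v w : S x -> smooth a -> tangent x v -> tangent x w ->
  (v *m extd (nabla a x) *m w^T) ord0 ord0 =
  dotv ('D_v (hom0 a) x) w - dotv ('D_w (hom0 a) x) v.
Proof.
move=> Sx sa xv xw; rewrite /extd mulmxBr mulmxBl mxE nablaE//.
have -> : v *m (nabla a x)^T *m w^T = (w *m nabla a x *m v^T)^T.
  by rewrite (trmx_mul (w *m _)) (trmx_mul w) trmxK mulmxA.
by rewrite mxE mxE nablaE.
Qed.

Lemma derive_radial (T : normedModType R) (f : E -> T) x :
  x != 0 -> differentiable (hom0 f) x -> 'D_x (hom0 f) x = 0.
Proof.
move=> x0 df.
have x1 : x + 0 *: x = x by rewrite scale0r addr0.
have := @is_derive_curve R E T (hom0 f) (fun s => x + s *: x) 0 x.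
rewrite x1 => /(_ df (is_derive_line _ _ _))[_ <-].
rewrite (near_eq_derive (g := cst (hom0 f x))) ?derive_cst//.
near=> s; rewrite /= -{1}[x]scale1r -scalerDl /hom0 unitvZ//.
near: s.
have : {for (0 : R), continuous (fun s : R => 1 + s)}.
  by apply: continuousD; [exact: cst_continuous|exact: cvg_id].
move=> /cvgr_gt; apply; rewrite addr0; exact: ltr01.
Unshelve. all: by end_near. Qed.

(** The Jacobian in the pullback is taken at [unitv x], so that every entry of the
extended pullback is a polynomial in composites of smooth functions with [unitv]
or with the extension of phi. *)
Lemma smooth_pullback phi b : smooth_self_map phi -> smooth b ->
  smooth (pullback phi b).
Proof.
move=> [Sphi sphi] sb k.
pose B := hom0 b; pose P := hom0 phi.
have SP x : x != 0 -> S (P x) by move=> x0; exact/Sphi/normv_unitv.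
apply: (@ndifferentiable_ext _ _ _ _ _
    (fun x => \row_j \sum_(i < n.+1)
       (B (P x) ord0 i * 'D_(delta_mx 0 j) (fun y => P y ord0 i) (unitv x)))) => //.
  move=> x x0; apply/rowP => j; rewrite /hom0 /pullback !mxE.
  apply: eq_bigr => i _; rewrite !mxE /B hom0_sphere; last exact: SP.
  congr (_ * _); rewrite -derive_coord; last first.
    by apply: smooth_differentiable => //; exact: unitv_neq0.
  by rewrite deriveE//; apply: smooth_differentiable => //; exact: unitv_neq0.
apply/ndifferentiable_rVP => // j.
rewrite (_ : (fun _ => _) = (fun x => \sum_(i < n.+1)
       (B (P x) ord0 i * 'D_(delta_mx 0 j) (fun y => P y ord0 i) (unitv x)))); last first.
  by apply/funext => x; rewrite mxE.
apply: ndifferentiable_sum => // i; apply: ndifferentiableM => //.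
  apply: (@ndifferentiable_comp _ _ _ _ _ nz P (fun y => B y ord0 i)) => //.
  - by move=> x x0; exact/normv1_neq0/SP.
  - by have /(_ i) := (ndifferentiable_rVP _ _ onz).1 (sb k).
apply: (@ndifferentiable_comp _ _ _ _ _ nz (@unitv R n.+1)
    ('D_(delta_mx 0 j) (fun y => P y ord0 i))) => //.
- by move=> x x0; exact: unitv_neq0.
- exact: ndifferentiable_unitv.
- by have /(_ i)[_] := (ndifferentiable_rVP _ _ onz).1 (sphi k.+1); exact.
Qed.

(** The extension of phi is constant along rays, so its Jacobian kills the radial
direction. *)
Lemma tangent_pullback phi b x : smooth phi -> S x -> tangent x (pullback phi b x).
Proof.
move=> sphi Sx; have x0 := normv1_neq0 Sx.
have dP := smooth_differentiable sphi x0.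
rewrite /tangent dotvE /pullback trmx_mul trmxK mulmxA -deriveEjacobian//.
by rewrite derive_radial// mul0mx mxE.
Qed.

Lemma smooth_ext a b : (forall x, S x -> a x = b x) -> smooth a -> smooth b.
Proof.
move=> ab sa k; apply: ndifferentiable_ext (sa k) => // x x0.
by apply: ab; exact: normv_unitv.
Qed.

Lemma smooth_form_pullback phi a b : smooth_self_map phi -> smooth b ->
  (forall x, S x -> a x = pullback phi b x) -> smooth_form a.
Proof.
move=> sphi sb ab; split.
  by move=> x Sx; rewrite ab//; apply: tangent_pullback => //; exact: sphi.2.
by apply: smooth_ext (smooth_pullback sphi sb) => x Sx; rewrite ab.
Qed.

(** The product and chain rules applied to (phi^* b)(v) = <b o phi, D_v phi>. *)
Lemma derive_pullback phi a b x v w : smooth_self_map phi -> smooth b ->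
  (forall x, S x -> a x = pullback phi b x) -> S x -> tangent x w ->
  dotv ('D_w (hom0 a) x) v =
  dotv ('D_('D_w (hom0 phi) x) (hom0 b) (phi x)) ('D_v (hom0 phi) x) +
  dotv (b (phi x)) ('D_w (fun y => 'D_v (hom0 phi) y) x).
Proof.
move=> sphi sb ab Sx xw; have x0 := normv1_neq0 Sx.
have [Sphi sp] := sphi.
pose B := hom0 b; pose P := hom0 phi.
have SP y : y != 0 -> S (P y) by move=> y0; exact/Sphi/normv_unitv.
have [_ sa] := smooth_form_pullback sphi sb ab.
have dA := smooth_differentiable sa x0.
have Px : P x = phi x by rewrite /P hom0_sphere.
have Bx : b (phi x) = B (P x) by rewrite /B Px hom0_sphere//; exact: Sphi.
have dP y : y != 0 -> differentiable P y by exact: smooth_differentiable.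
have dB : differentiable B (P x).
  by apply: smooth_differentiable => //; exact/normv1_neq0/SP.
have ux : unitv x = x by rewrite unitv_id.
have dPv : differentiable (fun y => 'D_v P y) (unitv x).
  by rewrite ux; exact: smooth_derive_differentiable.
have du := differentiable_unitv x0.
have -> : dotv ('D_w (hom0 a) x) v = 'D_w (fun y => dotv (hom0 a y) v) x.
  by rewrite (derive_dotv2 (g := cst v))// derive_cst dotv0r addr0.
rewrite (@near_eq_derive _ _ _ _
    (fun y => dotv ((B \o P) y) (((fun y => 'D_v P y) \o @unitv R n.+1) y))); last first.
  apply: filterS (open_nbhs_nbhs (conj onz x0)) => y y0.
  rewrite {1}/hom0 ab; last exact: normv_unitv.
  rewrite /pullback /= deriveEjacobian; last exact/dP/unitv_neq0.
  rewrite !dotvE -mulmxA -trmx_mul/= /B hom0_sphere; last exact: SP.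
  by [].
have dBP := differentiable_comp (dP x x0) dB.
have dPu := differentiable_comp du dPv.
have E1 : 'D_w (B \o P) x = 'D_('D_w P x) B (phi x).
  by apply: etrans (derive_comp w (dP x x0) dB) _; rewrite Px.
have E2 : 'D_w ((fun y => 'D_v P y) \o @unitv R n.+1) x = 'D_w (fun y => 'D_v P y) x.
  apply: etrans (derive_comp w du dPv) _.
  exact: (f_equal2 (fun u y => 'D_u (fun y => 'D_v P y) y) (derive_unitv Sx xw) ux).
apply: etrans (derive_dotv2 w dBP dPu) _.
by rewrite E1 E2 Bx /= ux.
Qed.

(** d (phi^* b) = phi^* (d b), evaluated at the tangent vectors v and w: the terms
that involve the second derivatives of phi cancel by symmetry. *)
Lemma extd_pullback phi a b x v w : smooth_self_map phi -> smooth b ->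
  (forall x, S x -> a x = pullback phi b x) ->
  S x -> tangent x v -> tangent x w ->
  dotv ('D_v (hom0 a) x) w - dotv ('D_w (hom0 a) x) v =
  dotv ('D_('D_v (hom0 phi) x) (hom0 b) (phi x)) ('D_w (hom0 phi) x) -
  dotv ('D_('D_w (hom0 phi) x) (hom0 b) (phi x)) ('D_v (hom0 phi) x).
Proof.
move=> sphi sb ab Sx xv xw.
have aux (p q c : R) : p + c - (q + c) = p - q.
  by rewrite opprD addrACA subrr addr0.
have E1 := derive_pullback w sphi sb ab Sx xv.
have E2 := derive_pullback v sphi sb ab Sx xw.
have E3 := congr1 (dotv (b (phi x)))
  (derive_commute_rV w v onz (normv1_neq0 Sx) (sphi.2 3)).
apply: etrans (congr2 (fun s t => s - t) E1 E2) _.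
apply: etrans (congr1 (fun s => _ + s - _) E3) _.
exact: aux.
Qed.

(** On the sphere phi o psi is the identity, so the composite of the extensions is
the radial projection, whose derivative fixes tangent vectors. *)
Lemma surjective_pushforward phi psi y w :
  smooth_self_map phi -> smooth_self_map psi ->
  (forall x, S x -> psi (phi x) = x /\ phi (psi x) = x) ->
  S y -> tangent y w ->
  'D_('D_w (hom0 psi) y) (hom0 phi) (psi y) = w.
Proof.
move=> [Sphi sphi] [Spsi spsi] inv Sy yw; have y0 := normv1_neq0 Sy.
have dpsi := smooth_differentiable spsi y0.
have Py : hom0 psi y = psi y by rewrite hom0_sphere.
have dphi : differentiable (hom0 phi) (hom0 psi y).
  by apply: smooth_differentiable => //; rewrite Py; exact/normv1_neq0/Spsi.
rewrite -[RHS](derive_unitv Sy yw).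
have -> : 'D_w (@unitv R n.+1) y = 'D_w (hom0 phi \o hom0 psi) y.
  apply: near_eq_derive; apply: filterS (open_nbhs_nbhs (conj onz y0)) => x x0.
  rewrite /hom0 /= (@unitv_id _ _ (psi _)); last exact/Spsi/normv_unitv.
  by rewrite (inv _ (normv_unitv x0)).2.
by rewrite (derive_comp w dpsi dphi) Py.
Qed.

Lemma tangent_derive psi y w : smooth_self_map psi -> S y ->
  tangent (psi y) ('D_w (hom0 psi) y).
Proof.
move=> [Spsi spsi] Sy; have y0 := normv1_neq0 Sy.
have dpsi := smooth_differentiable spsi y0.
have D0 : 'D_w (fun x => dotv (hom0 psi x) (hom0 psi x)) y = 0.
  apply: (derive_locally_cst _ onz y0) => x x0.
  by apply: dotv1; exact/Spsi/normv_unitv.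
move: (etrans (esym (derive_dotv2 w dpsi dpsi)) D0).
rewrite hom0_sphere// dotvC -mulr2n => /eqP.
by rewrite mulrn_eq0/= => /eqP.
Qed.

(** The Killing equation expresses the covariant derivative through d b. *)
Lemma killing_closed_parallel b : killing b ->
  (forall y v w, S y -> tangent y v -> tangent y w ->
     dotv ('D_v (hom0 b) y) w - dotv ('D_w (hom0 b) y) v = 0) ->
  forall y v w, S y -> tangent y v -> tangent y w -> dotv ('D_v (hom0 b) y) w = 0.
Proof.
move=> [[_ sb] _ kb] closed y v w Sy yv yw.
rewrite -nablaE// kb// -scalemxAl mxE extdE//.
by rewrite closed// mulr0.
Qed.

(** * Parallel forms on the sphere *)

Section parallel.
Variable b : E -> E.
Hypothesis sb : smooth_form b.
Hypothesis parallel : forall y v w, S y -> tangent y v -> tangent y w ->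
  dotv ('D_v (hom0 b) y) w = 0.

Let B := hom0 b.

(** The tangential part of the derivative vanishes by assumption; the normal part
follows by differentiating <b y, y> = 0. *)
Lemma parallel_derive y v : S y -> tangent y v -> 'D_v B y = - dotv (b y) v *: y.
Proof.
move=> Sy yv; have y0 := normv1_neq0 Sy; have [tb sm] := sb.
have dB := smooth_differentiable sm y0.
have yy := dotv1 Sy.
have H1 : dotv ('D_v B y) y = - dotv (b y) v.
  have D0 : 'D_v (fun x => dotv (B x) x) y = 0.
    apply: (derive_locally_cst (c := 0) _ onz y0) => x x0.
    have := tb _ (normv_unitv x0); rewrite /tangent {1}/unitv dotvZl dotvC => /eqP.
    by rewrite mulf_eq0 invr_eq0 normv_eq0 (negbTE (x0 : x != 0))/= => /eqP.
  have did : differentiable (id : E -> E) y by [].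
  move: (etrans (esym (derive_dotv2 v dB did)) D0).
  by rewrite derive_id /B hom0_sphere// => /eqP; rewrite addr_eq0 => /eqP.
rewrite -H1; apply/eqP; rewrite -subr_eq0 -dotv_eq0.
set z := _ - _.
have yz : tangent y z by rewrite /tangent /z dotvDr dotvNr dotvZr yy mulr1 dotvC subrr.
by rewrite {1}/z dotvDl dotvNl dotvZl yz mulr0 subr0 parallel.
Qed.

(** Along the great circle from p through q, the components of b in the direction
of the velocity and in each fixed direction normal to p and q are constant. *)
Lemma parallel_transport p q : S p -> S q -> tangent p q ->
  dotv (b q) p = - dotv (b p) q /\
  forall e, tangent p e -> tangent q e -> dotv (b q) e = dotv (b p) e.
Proof.
move=> Sp Sq pq.
pose c : R -> E := fun s => cos s *: p + sin s *: q.
pose c' : R -> E := fun s => - sin s *: p + cos s *: q.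
have pp := dotv1 Sp; have qq := dotv1 Sq.
have qp : dotv q p = 0 by rewrite dotvC.
have Sc s : S (c s).
  rewrite /S/= /sphere/= /normv !(dotvDl, dotvDr, dotvZl, dotvZr) pp qq qp pq.
  by rewrite !mulr0 !mulr1 addr0 add0r -!expr2 cos2Dsin2 sqrtr1.
have tc s : tangent (c s) (c' s).
  rewrite /tangent !(dotvDl, dotvDr, dotvZl, dotvZr) pp qq qp pq.
  by rewrite !mulr0 !mulr1 addr0 add0r mulrN mulrC addNr.
have dc (s : R) : is_derive s 1 c (c' s) by exact: is_derive_circle.
have dc' (s : R) : is_derive s 1 c' (- c s).
  rewrite /c' /c opprD -!scaleNr.
  apply: (is_deriveD (f := fun s => - sin s *: p) (g := fun s => cos s *: q)).
    by apply: (is_derive_scalel (k := fun s => - sin s)); exact: is_deriveN.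
  exact: is_derive_scalel.
have c0 : c 0 = p by rewrite /c cos0 sin0 scale1r scale0r addr0.
have c1 : c (pi / 2) = q by rewrite /c cos_pihalf sin_pihalf scale1r scale0r add0r.
have c'0 : c' 0 = q by rewrite /c' cos0 sin0 oppr0 scale1r scale0r add0r.
have c'1 : c' (pi / 2) = - p.
  by rewrite /c' cos_pihalf sin_pihalf scale0r addr0 scaleN1r.
have dB (s : R) : is_derive s 1 (B \o c) (- dotv (b (c s)) (c' s) *: c s).
  have dBs : differentiable B (c s).
    by apply: smooth_differentiable; [exact: sb.2|exact/normv1_neq0/Sc].
  exact: is_derive_eq (is_derive_curve dBs (dc s)) (parallel_derive (Sc s) (tc s)).
have Bp : B p = b p by rewrite /B hom0_sphere.
have Bq : B q = b q by rewrite /B hom0_sphere.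
have Bc s : b (c s) = B (c s) by rewrite /B hom0_sphere//; exact: Sc.
split.
- have dBc (s : R) : is_derive s 1 (fun s => dotv (B (c s)) (c' s)) 0.
    apply: is_derive_eq (is_derive_dotv (dB s) (dc' s)) _.
    rewrite dotvZl (tc s : dotv _ _ = 0) mulr0 add0r dotvNr /= -Bc dotvC.
    by rewrite (sb.1 _ (Sc s) : dotv _ _ = 0) oppr0.
  have := is_derive_0_is_cst 0 (pi / 2) dBc.
  by rewrite c0 c1 c'0 c'1 Bp Bq dotvNr => ->; rewrite opprK.
- move=> e pe qe; have dBc (s : R) : is_derive s 1 (fun s => dotv (B (c s)) e) 0.
    apply: is_derive_eq (is_derive_dotv (dB s) (is_derive_cst e s 1)) _.
    rewrite dotvZl {2}/c dotvDl !dotvZl (pe : dotv _ _ = 0) (qe : dotv _ _ = 0).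
    by rewrite !mulr0 addr0 mulr0 dotv0r addr0.
  have := is_derive_0_is_cst 0 (pi / 2) dBc.
  by rewrite c0 c1 Bp Bq => ->.
Qed.

(** Let p, q, e be orthonormal. The form b is parallel along the three sides of the
octant with these vertices, and going around it turns e into - q. This gives
<b p, e> = - <b p, q>; with - q in place of q both sides vanish. *)
Lemma parallel_eq0 : (2 <= n)%N -> forall p, S p -> b p = 0.
Proof.
move=> n2 p Sp.
have orth q e : S p -> S q -> S e -> tangent p q -> tangent p e -> tangent q e ->
    dotv (b p) e = - dotv (b p) q.
  move=> {}Sp Sq Se pq pe qe.
  have qp : tangent q p by rewrite /tangent dotvC.
  have ep : tangent e p by rewrite /tangent dotvC.
  have eq : tangent e q by rewrite /tangent dotvC.
  have [_ /(_ e pe qe) <-] := parallel_transport Sp Sq pq.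
  have [H _] := parallel_transport Se Sq eq.
  have [_ /(_ q pq eq) <-] := parallel_transport Sp Se pe.
  by rewrite H.
have tb := sb.1 p Sp.
apply/eqP/negP => /negP bp0.
pose e := unitv (b p).
have Se : S e by exact: normv_unitv.
have pe : tangent p e by rewrite /tangent /e /unitv dotvZr tb mulr0.
have [q [Sq pq eq]] : exists q, [/\ S q, tangent p q & tangent e q].
  (* p and e span a plane, and the ambient dimension is at least 3. *)
  pose K := kermx (col_mx p e)^T.
  have K0 : K != 0.
    rewrite -mxrank_eq0 mxrank_ker -lt0n subn_gt0.
    apply: leq_ltn_trans (rank_leq_col _) _.
    by [].
  have [i Ki] : exists i, row i K != 0.
    apply/existsP; move: K0; apply: contraNT; rewrite negb_exists => /forallP H.
    by apply/eqP/row_matrixP => i; apply/eqP; rewrite row0; move: (H i); rewrite negbK.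
  have : row i K *m (col_mx p e)^T = 0 by rewrite -row_mul mulmx_ker row0.
  rewrite tr_col_mx mul_mx_row -[0]row_mx0 => /eq_row_mx[H1 H2].
  exists (unitv (row i K)); split.
  - exact: normv_unitv.
  - by rewrite /tangent /unitv dotvZr dotvC dotvE H1 mxE mulr0.
  - by rewrite /tangent /unitv dotvZr dotvC dotvE H2 mxE mulr0.
have qe : tangent q e by rewrite /tangent dotvC.
have H1 := orth q e Sp Sq Se pq pe qe.
have SNq : S (- q) by rewrite /S /sphere/= -scaleN1r normvZ normrN1 mul1r.
have H2 : dotv (b p) e = - dotv (b p) (- q).
  by apply: orth => //; rewrite /tangent ?dotvNr ?dotvNl ?pq ?qe ?oppr0.
have : dotv (b p) e = 0.
  move: H1 H2; rewrite dotvNr opprK => -> /eqP.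
  by rewrite eq_sym -addr_eq0 -mulr2n mulrn_eq0/= => /eqP ->; rewrite oppr0.
rewrite /e /unitv dotvZr -sqr_normv => /eqP; rewrite mulf_eq0 invr_eq0 sqrf_eq0.
by rewrite orbb normv_eq0 (negbTE bp0).
Qed.

End parallel.

End sphere_calculus.
(** * Forms of the family are not closed *)

Section calM_curl.
Variables (R : realType) (n : nat).
Local Notation E := 'rV[R]_n.+1.
Local Notation S := (@sphere R n).

Lemma calM_smooth_form (a : E -> E) : calM a -> smooth_form a.
Proof.
move=> [[[//]]|[phi [b [[sphi _ _] [[[_ sb] _ _] _] ab]]]].
exact: smooth_form_pullback ab.
Qed.

(** Closedness passes from a pullback phi^* b to b because the differential of phi
is onto each tangent space, and a closed Killing form is parallel, hence zero. *)
Lemma calM_extd_neq0 (a : E -> E) : (2 <= n)%N -> calM a ->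
  exists x, S x /\ extd (nabla a x) != 0.
Proof.
move=> n2 Ma; have [_ sa] := calM_smooth_form Ma.
apply: contrapT => closed.
have {}closed x v w : S x -> tangent x v -> tangent x w ->
    dotv ('D_v (hom0 a) x) w - dotv ('D_w (hom0 a) x) v = 0.
  move=> Sx xv xw; rewrite -extdE//.
  have -> : extd (nabla a x) = 0.
    by apply/eqP/negP => /negP ?; apply: closed; exists x.
  by rewrite mulmx0 mul0mx mxE.
case: Ma => [[ka [x [Sx /eqP ax]]]|].
  by apply: ax; apply: parallel_eq0 => //; [case: ka|exact: killing_closed_parallel].
move=> [phi [b [[sphi [psi [spsi inv]] _] [kb [y [Sy /eqP by0]]] ab]]]; apply: by0.
have sb : smooth b by case: kb => -[].
apply: parallel_eq0 => //; first by case: kb.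
apply: killing_closed_parallel => // {Sy}y v w Sy yv yw.
have Sx := spsi.1 y Sy.
have tv := tangent_derive v spsi Sy.
have tw := tangent_derive w spsi Sy.
have Ev := surjective_pushforward sphi spsi inv Sy yv.
have Ew := surjective_pushforward sphi spsi inv Sy yw.
pose db u u' z := dotv ('D_u (hom0 b) z) u' - dotv ('D_u' (hom0 b) z) u.
apply: etrans (esym (f_equal3 db Ev Ew (inv y Sy).2)) _.
exact: etrans (esym (extd_pullback sphi sb ab Sx tv tw)) (closed _ _ _ Sx tv tw).
Qed.

End calM_curl.
(** * Clarkson's inequality *)

Section clarkson.
Variable R : realType.

(** The tangent-line inequality at s^2 = m^2 for the convex function u |-> u^(k/2+1)
of u = s^2, doubled and written without fractional powers. *)
Lemma ler_tangent_expr (s m : R) k : 0 <= s -> 0 <= m ->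
  2 * m ^+ k.+2 + k.+2%:R * m ^+ k * (s ^+ 2 - m ^+ 2) <= 2 * s ^+ k.+2.
Proof.
move=> s0 m0; elim: k => [|k IH]; first by rewrite expr0; lra.
have := ler_wpM2l s0 IH.
have p0 : 0 <= m ^+ k by exact: exprn_ge0.
have H : 0 <= (s - m) ^+ 2 * (m ^+ k * (k.+2%:R * s + k.+1%:R * m)).
  apply: mulr_ge0; first exact: sqr_ge0.
  by apply: mulr_ge0 => //; apply: addr_ge0; apply: mulr_ge0.
move=> H2; rewrite -subr_ge0 in H2; rewrite -subr_ge0.
(* The left-hand side at k + 1 is s times the one at k plus H. *)
have := addr_ge0 H2 H; congr (0 <= _).
by rewrite !exprS -!natr1; ring.
Qed.

(** With m^2 = p^2 + q^2, the first-order terms of the tangent lines at s and r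
cancel, since s^2 and r^2 have mean m^2; and m^(k+2) >= p^(k+2) + q^(k+2). *)
Lemma clarkson_scalar (s r p q : R) k : 0 <= s -> 0 <= r -> 0 <= p -> 0 <= q ->
  s ^+ 2 + r ^+ 2 = 2 * (p ^+ 2 + q ^+ 2) ->
  2 * (p ^+ k.+2 + q ^+ k.+2) <= s ^+ k.+2 + r ^+ k.+2.
Proof.
move=> s0 r0 p0 q0 par; pose m := Num.sqrt (p ^+ 2 + q ^+ 2).
have m0 : 0 <= m := sqrtr_ge0 _.
have pq0 : 0 <= p ^+ 2 + q ^+ 2 by rewrite addr_ge0// sqr_ge0.
have m2 : m ^+ 2 = p ^+ 2 + q ^+ 2 by rewrite sqr_sqrtr.
have pm : p <= m.
  by rewrite -(ler_pXn2r (n := 2)) ?nnegrE// m2 lerDl sqr_ge0.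
have qm : q <= m.
  by rewrite -(ler_pXn2r (n := 2)) ?nnegrE// m2 lerDr sqr_ge0.
have Hs := ler_tangent_expr k s0 m0.
have Hr := ler_tangent_expr k r0 m0.
have Hm : p ^+ k.+2 + q ^+ k.+2 <= m ^+ k.+2.
  rewrite -(addn2 k) !(exprD _ k 2) m2 mulrDr lerD//; apply: ler_wpM2r; rewrite ?sqr_ge0//.
    by rewrite lerXn2r.
  by rewrite lerXn2r.
have E : s ^+ 2 - m ^+ 2 = - (r ^+ 2 - m ^+ 2) by rewrite m2; lra.
rewrite E mulrN in Hs.
move: Hs Hr; set c := _ * (_ - _) => Hs Hr; lra.
Qed.

Lemma clarkson m (a b : 'rV[R]_m) k :
  2 * (normv a ^+ k.+2 + normv b ^+ k.+2) <=
  normv (a + b) ^+ k.+2 + normv (a - b) ^+ k.+2.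
Proof.
apply: clarkson_scalar; rewrite ?normv_ge0// !sqr_normv.
rewrite !(dotvDl, dotvDr, dotvNl, dotvNr) (dotvC b a); ring.
Qed.

End clarkson.

(** * Positivity of the norm of the Hodge star *)

Section hodge.
Variables (R : realType) (n : nat).
Local Notation E := 'rV[R]_n.+1.
Local Notation e_ := (@basis_vec R n).

Lemma volume_formDZ (x y : E) c vs : volume_form (x + c *: y) vs =
  volume_form x vs + c * volume_form y vs.
Proof.
rewrite /volume_form; pose A := \matrix_(r < n.+1) nth 0 (x + c *: y :: vs) r.
rewrite (determinant_multilinear (A := A) (B := \matrix_(r < n.+1) nth 0 (x :: vs) r)
  (C := \matrix_(r < n.+1) nth 0 (y :: vs) r) (i0 := ord0) (b := 1) (c := c)) ?mul1r//.
- by apply/rowP => j; rewrite !mxE/= mul1r.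
- by apply/matrixP => i j; rewrite !mxE lift0/=.
- by apply/matrixP => i j; rewrite !mxE lift0/=.
Qed.

Lemma volume_form0 vs : volume_form (0 : E) vs = 0.
Proof.
have := volume_formDZ 0 0 (-1) vs; rewrite scaler0 addr0 mulN1r addrN; exact.
Qed.

Lemma volume_form_sum (x : E) vs :
  volume_form x vs = \sum_c x ord0 c * volume_form (e_ c) vs.
Proof.
rewrite {1}[x]row_sum_delta; elim/big_rec2: _ => [|c y z _ IH].
  exact: volume_form0.
by rewrite addrC volume_formDZ IH addrC.
Qed.

Lemma volume_form_rep (vs : seq E) (x : E) i j : (i < j < (size vs).+1)%N ->
  ((size vs).+1 <= n.+1)%N -> nth 0 (x :: vs) i = nth 0 (x :: vs) j ->
  volume_form x vs = 0.
Proof.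
move=> /andP[ij js] sn E; rewrite /volume_form.
have jn := leq_trans js sn; have i_n := ltn_trans ij jn.
apply: (@determinant_alternate _ _ _ (Ordinal i_n) (Ordinal jn)).
  by rewrite -val_eqE/= neq_ltn ij.
by move=> k; rewrite !mxE /= E.
Qed.

Lemma volume_form_not_uniq (s : seq 'I_n.+1) (c : 'I_n.+1) : (size s <= n)%N ->
  ~~ uniq (c :: s) -> volume_form (e_ c) [seq e_ i | i <- s] = 0.
Proof.
move=> sn /(uniqPn c)[i [j [ij js E]]].
apply: (@volume_form_rep _ _ i j); rewrite ?size_map ?ij//.
have is' := ltn_trans ij js.
rewrite -[_ :: _]/[seq e_ i | i <- c :: s].
by rewrite !(nth_map c)// E.
Qed.

Lemma volume_form_uniq (s : seq 'I_n.+1) (c : 'I_n.+1) : size s = n ->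
  uniq (c :: s) -> volume_form (e_ c) [seq e_ i | i <- s] != 0.
Proof.
move=> sn us.
pose f (r : 'I_n.+1) := nth c (c :: s) r.
have inj_f : injective f.
  move=> i j /eqP; rewrite nth_uniq//= ?sn// => /eqP; exact: val_inj.
rewrite /volume_form (_ : \matrix_r _ = perm_mx (perm inj_f)).
  by rewrite det_perm signr_eq0.
apply/matrixP => i j; rewrite !mxE permE -[_ :: _]/[seq e_ i | i <- c :: s].
rewrite (nth_map c) /= ?sn//.
by rewrite /f /basis_vec mxE eqxx eq_sym.
Qed.

Lemma det_row_swap (M N : 'M[R]_n.+1) (i j : 'I_n.+1) : i != j ->
  (forall r, row r N = row (tperm i j r) M) -> \det N = - \det M.
Proof.
move=> ij NM; have -> : N = row_perm (tperm i j) M.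
  by apply/row_matrixP => r; rewrite NM; apply/rowP => k; rewrite !mxE.
by rewrite row_permE det_mulmx det_perm odd_tperm ij expr1 mulN1r.
Qed.

Lemma volume_form_swap01 (u v : E) vs : (0 < n)%N ->
  volume_form u (v :: vs) = - volume_form v (u :: vs).
Proof.
move=> n0; have n1 : (1 < n.+1)%N by [].
apply: (@det_row_swap _ _ ord0 (Ordinal n1)) => // r.
apply/rowP => k; rewrite !mxE; congr (fun_of_matrix _ _ _).
case: tpermP => [->|->|] //= r0 r1.
case: r r0 r1 => -[|[|r]] ir //= r0 r1.
- by case: r0; apply: val_inj.
- by case: r1; apply: val_inj.
Qed.

Lemma volume_form_swap12 (u v z : E) vs : (1 < n)%N ->
  volume_form z (u :: v :: vs) = - volume_form z (v :: u :: vs).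
Proof.
move=> n0; have n1 : (1 < n.+1)%N by exact: ltnW.
have n2 : (2 < n.+1)%N by [].
apply: (@det_row_swap _ _ (Ordinal n1) (Ordinal n2)) => // r.
apply/rowP => k; rewrite !mxE; congr (fun_of_matrix _ _ _).
case: tpermP => [->|->|] //= r0 r1.
case: r r0 r1 => -[|[|[|r]]] ir //= r0 r1.
- by case: r0; apply: val_inj.
- by case: r1; apply: val_inj.
Qed.

Lemma sum_support3 (I : finType) (l i j : I) (g : I -> R) :
  uniq [:: l; i; j] -> (forall a, a \notin [:: l; i; j] -> g a = 0) ->
  \sum_a g a = g l + g i + g j.
Proof.
move=> u g0; rewrite (bigID (mem [:: l; i; j]))/= [X in _ + X]big1 // addr0.
rewrite -big_uniq//= !big_cons big_nil addr0 addrA.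
by [].
Qed.

Lemma sum_sym_lt (F : 'I_n.+1 -> 'I_n.+1 -> R) :
  (forall a b, F a b = F b a) -> (forall a, F a a = 0) ->
  \sum_a \sum_b F a b = 2 * \sum_(a < n.+1) \sum_(b < n.+1 | (a < b)%N) F a b.
Proof.
move=> Fs F0.
rewrite mulr_natl mulr2n [X in _ = _ + X](exchange_big_dep xpredT)//= -big_split/=.
apply: eq_bigr => a _; rewrite (bigID (fun b : 'I_n.+1 => (a < b)%N))/=; congr (_ + _).
rewrite (bigD1 a)/= ?ltnn// F0 add0r.
under [RHS]eq_bigr do rewrite Fs.
apply: eq_bigl => b; rewrite -leqNgt ltn_neqAle andbC -val_eqE.
by [].
Qed.

(** Evaluating * w at x on the basis vectors complementary to e_l, e_i, e_j extracts,
up to sign, the (l, i, j) component of the 3-form x /\ w: in the expansion of the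
determinants along x only the six orderings of l, i, j survive. *)
Lemma hodge2_complement (x : E) (w : 'M[R]_n.+1) (l i j : 'I_n.+1)
    (s : seq 'I_n.+1) :
  (1 < n)%N -> w^T = - w -> size s = n.-2 -> uniq [:: l; i; j] ->
  (forall k, k \notin [:: l; i; j] -> k \in s) ->
  hodge2 x w [seq e_ k | k <- s] =
  volume_form (e_ l) (e_ i :: e_ j :: [seq e_ k | k <- s]) *
  (x ord0 l * w i j + x ord0 i * w j l + x ord0 j * w l i).
Proof.
move=> n1 wT ss us3 compl; set vs := [seq e_ k | k <- s].
have n0 : (0 < n)%N by exact: ltnW.
have wA a b : w b a = - w a b by have /matrixP/(_ a b) := wT; rewrite !mxE.
pose D c a b := volume_form (e_ c) (e_ a :: e_ b :: vs).
have D0 c a b : ~~ uniq [:: c, a, b & s] -> D c a b = 0.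
  move=> nu; apply: (@volume_form_not_uniq (a :: b :: s)) => //=.
  by rewrite ss; case: (n) n1 => [|[|]].
have Dc c a b : c \notin [:: l; i; j] -> D c a b = 0.
  by move=> /compl cs; apply: D0; rewrite /= !inE cs !orbT.
have Da c a b : a \notin [:: l; i; j] -> D c a b = 0.
  by move=> /compl cs; apply: D0; rewrite /= !inE cs !orbT !andbF.
have Db c a b : b \notin [:: l; i; j] -> D c a b = 0.
  by move=> /compl cs; apply: D0; rewrite /= cs !andbF.
have Dca c b : D c c b = 0 by apply: D0; rewrite /= !inE eqxx.
have Dab c a : D c a a = 0 by apply: D0; rewrite /= !inE eqxx !andbF.
have Dcb c a : D c a c = 0 by apply: D0; rewrite /= !inE eqxx !orbT.
have D01 c a b : D c a b = - D a c b by exact: volume_form_swap01.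
have D12 c a b : D c a b = - D c b a by exact: volume_form_swap12.
pose V a b := volume_form x (e_ a :: e_ b :: vs).
have VE a b : V a b = x ord0 l * D l a b + x ord0 i * D i a b + x ord0 j * D j a b.
  rewrite /V volume_form_sum (sum_support3 us3)// => c cL.
  by rewrite -[volume_form _ _]/(D c a b) Dc// mulr0.
have V12 a b : V a b = - V b a by exact: volume_form_swap12.
have : 2 * hodge2 x w vs = \sum_a \sum_b w a b * V a b.
  rewrite (@sum_sym_lt (fun a b => w a b * V a b))//.
    by move=> a b; rewrite wA V12 mulrNN.
  by move=> a; rewrite VE !Dab !mulr0 !addr0 mulr0.
have Va a b : a \notin [:: l; i; j] -> V a b = 0.
  by move=> aL; rewrite VE !Da// !mulr0 !addr0.
rewrite (sum_support3 us3); last first.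
  by move=> a aL; rewrite big1// => b _; rewrite Va ?mulr0.
have Vb a : \sum_b w a b * V a b = w a l * V a l + w a i * V a i + w a j * V a j.
  by rewrite (sum_support3 us3)// => b bL; rewrite V12 Va// oppr0 mulr0.
rewrite !Vb !VE !(Dca, Dab, Dcb) !(mulr0, addr0, add0r).
rewrite (wA l i) (wA l j) (wA i j) (D01 i l j) (D12 l j i) (D12 i j l) (D12 j i l).
rewrite (D01 j l i) (D12 l j i) (D01 i l j) -/(D l i j) => H.
apply: (@mulfI _ (2 : R)); first by rewrite pnatr_eq0.
by rewrite H; ring.
Qed.

(** If * w vanished, all components of x /\ w would; contracting x /\ w with the unit
vector x gives back w, because w is tangential. *)
Lemma norm_form_hodge2_gt0 (x : E) (w : 'M[R]_n.+1) :
  (1 < n)%N -> normv x = 1 -> w^T = - w -> w *m x^T = 0 -> w != 0 ->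
  0 < norm_form n.-2 (hodge2 x w).
Proof.
move=> n1 x1 wT wx w0.
have wA a b : w b a = - w a b by have /matrixP/(_ a b) := wT; rewrite !mxE.
pose Q l i j := x ord0 l * w i j + x ord0 i * w j l + x ord0 j * w l i.
(* Q l i j is the (l, i, j) component of x /\ w. *)
have [l [i [j Q0]]] : exists l i j, Q l i j != 0.
  apply: contrapT => nQ; move/eqP: w0; apply; apply/matrixP => i j; rewrite [RHS]mxE.
  have wx0 a : \sum_l w a l * x ord0 l = 0.
    have /matrixP/(_ a ord0) := wx; rewrite !mxE => H; rewrite -[RHS]H.
    by apply: eq_bigr => k _; rewrite mxE.
  have : \sum_l x ord0 l * Q l i j = 0.
    apply: big1 => l _; suff -> : Q l i j = 0 by rewrite mulr0.
    by apply/eqP/negP => /negP ?; apply: nQ; exists l, i, j.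
  rewrite (eq_bigr (fun l => x ord0 l * x ord0 l * w i j +
     (w j l * x ord0 l * x ord0 i - w i l * x ord0 l * x ord0 j))); last first.
    by move=> l _; rewrite /Q (wA i l); ring.
  rewrite big_split/= sumrB -!mulr_suml !wx0 !mul0r subr0 addr0.
  by rewrite -/(dotv x x) (dotv1 x1) mul1r.
have wd a : w a a = 0.
  by apply/eqP; have /eqP := wA a a; rewrite -addr_eq0 -mulr2n mulrn_eq0.
have us3 : uniq [:: l; i; j].
  rewrite /= !inE negb_or !andbT; apply/andP; split; [apply/andP; split|];
    apply: contraNneq Q0 => ->; rewrite /Q wd.
  - by rewrite (wA j i); apply/eqP; ring.
  - by rewrite (wA i j); apply/eqP; ring.
  - by rewrite (wA j l); apply/eqP; ring.
pose s := [seq k <- enum 'I_n.+1 | k \notin [:: l; i; j]].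
have ss : size s == n.-2.
  have := count_predC (mem [:: l; i; j]) (enum 'I_n.+1).
  rewrite size_enum_ord /s size_filter.
  have -> : count (mem [:: l; i; j]) (enum 'I_n.+1) = 3%N.
    rewrite -size_filter -[3%N]/(size [:: l; i; j]); apply/perm_size/uniq_perm => //.
      by rewrite filter_uniq// enum_uniq.
    by move=> k; rewrite mem_filter mem_enum andbT.
  rewrite !addSn add0n => /(congr1 (fun m => m.-1.-2)) /= E3.
  by apply/eqP; rewrite -[RHS]E3; apply: eq_count => k; rewrite !inE.
have compl k : k \notin [:: l; i; j] -> k \in s.
  by move=> kL; rewrite mem_filter kL mem_enum.
rewrite /norm_form sqrtr_gt0; apply: mulr_gt0.
  by rewrite invr_gt0 ltr0n fact_gt0.
rewrite (bigD1 (Tuple ss))//=; apply: ltr_wpDr.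
  by apply: sumr_ge0 => t _; exact: sqr_ge0.
rewrite lt_def sqr_ge0 andbT sqrf_eq0 (hodge2_complement x n1 wT (eqP ss) us3 compl).
rewrite mulf_neq0//.
apply: (@volume_form_uniq (i :: j :: s)).
  by rewrite /= (eqP ss); case: (n) n1 => [|[|]].
have ns k : k \in [:: l; i; j] -> k \notin s.
  by move=> kL; rewrite mem_filter kL.
have us : uniq s by rewrite filter_uniq// enum_uniq.
move: us3; rewrite /= !inE !negb_or us !ns ?inE ?eqxx ?orbT// !andbT.
by [].
Qed.

Lemma extd_tr (A : 'M[R]_n.+1) : (extd A)^T = - extd A.
Proof. by rewrite /extd linearB/= trmxK opprB. Qed.

Lemma tproj_normal (x : E) : normv x = 1 -> tproj x *m x^T = 0.
Proof.
move=> x1; rewrite mulmxBl mul1mx -mulmxA.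
have -> : x *m x^T = 1%:M by rewrite [LHS]mx11_scalar -dotvE dotv1.
by rewrite mulmx1 subrr.
Qed.

Lemma extd_nabla_normal (a : E -> E) (x : E) : normv x = 1 ->
  extd (nabla a x) *m x^T = 0.
Proof.
move=> x1; have T0 := tproj_normal x1.
have Tt : (tproj x)^T = tproj x by rewrite /tproj linearB/= trmx1 trmx_mul trmxK.
by rewrite /extd /nabla mulmxBl !trmx_mul Tt -!mulmxA T0 !mulmx0 subrr.
Qed.

End hodge.
(** * Lebesgue measure and Borel sets of R^m *)

Section rV_borel.
Variable R : realType.

Definition cube m (a : 'rV[R]_m) (r : R) : set 'rV[R]_m :=
  [set y | forall i, a ord0 i - r <= y ord0 i <= a ord0 i + r].

Lemma measurable_cube m (a : 'rV[R]_m) (r : R) : measurable (cube a r).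
Proof.
rewrite (_ : cube a r = \bigcap_(i in [set: 'I_m])
    ((fun y : 'rV[R]_m => y ord0 i) @^-1` `[a ord0 i - r, a ord0 i + r])).
  apply: fin_bigcap_measurable => [|i _]; first exact: finite_finset.
  by rewrite -[X in measurable X]setTI; exact: measurable_coord.
apply/seteqP; split => y; first by move=> H i _; rewrite /= in_itv/=; exact: H.
by move=> H i; have := H i I; rewrite /= in_itv.
Qed.

Lemma cube_sub_ball m (x a : 'rV[R]_m) (r e : R) : 0 < e -> r + r < e ->
  cube a r x -> cube a r `<=` ball x e.
Proof.
move=> e0 re xa y ya; split => // i j; rewrite !ord1 /ball/=.
have /andP[x1 x2] := xa j; have /andP[y1 y2] := ya j.
by apply: le_lt_trans re; rewrite ler_norml; apply/andP; split; lra.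
Qed.

(** An open set is the union of the countably many cubes with rational center and
radius 1 / (k + 1) that it contains. *)
Lemma open_measurable_rV m (U : set 'rV[R]_m) : open U -> measurable U.
Proof.
move=> oU.
pose B (p : 'rV[rat]_m * nat) := cube (map_mx (@ratr R) p.1) p.2.+1%:R^-1.
rewrite (_ : U = \bigcup_p (if `[< B p `<=` U >] then B p else set0)).
  apply: countable_bigcupT_measurable => [|p]; first exact: countableP.
  by case: ifP => // _; exact: measurable_cube.
apply/seteqP; split => x; last first.
  by move=> [p _]; case: asboolP => // pU px; exact: pU.
move=> Ux; have /nbhs_ballP[e /= e0 xe] := open_nbhs_nbhs (conj oU Ux).
have [k ke] : exists k, k.+1%:R^-1 + k.+1%:R^-1 < e.
  have e2 : 0 < e / 2 by rewrite divr_gt0.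
  have [k] := ltr_add_invr e2; rewrite add0r => ke.
  by exists k; rewrite [ltRHS]splitr; exact: ltrD.
have k0 : 0 < k.+1%:R^-1 :> R by rewrite invr_gt0.
have qP i : exists q : rat, x ord0 i - k.+1%:R^-1 < ratr q < x ord0 i + k.+1%:R^-1.
  have : x ord0 i - k.+1%:R^-1 < x ord0 i + k.+1%:R^-1 by rewrite ltrD2l (lt_trans _ k0)// oppr_lt0.
  by move=> /rat_in_itvoo[q]; rewrite in_itv/=; exists q.
pose q := \row_i projT1 (cid (qP i)).
have Bx : B (q, k) x.
  move=> i; rewrite !mxE; case: cid => /= z /andP[z1 z2].
  by rewrite lerBlDr (ltW z2)/= -lerBlDr ltW.
exists (q, k) => //; case: asboolP => // -[].
exact: subset_trans (cube_sub_ball e0 ke Bx) xe.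
Qed.

Lemma continuous_measurable_rV m (D : set 'rV[R]_m) (f : 'rV[R]_m -> R) :
  measurable D -> {within D, continuous f} -> measurable_fun D f.
Proof.
move=> mD /continuousP cf; apply: (measurability _ (RGenOpens.measurableE R)).
move=> _ [_ [a [b ->] <-]]; have /cf : open `]a, b[%classic by exact: interval_open.
move=> /open_subspaceP[V oV VD]; rewrite setIC -VD.
by apply: measurableI => //; exact: open_measurable_rV.
Qed.

Lemma lebesgue_rV_cube m (a : 'rV[R]_m) (r : R) : 0 < r ->
  lebesgue_rV R m (cube a r) = ((r + r) ^+ m)%:E.
Proof.
move=> r0; elim: m a => [|m IH] a.
  rewrite /= diracE expr0 mem_set// => i; case: i => //.
rewrite /= /cons_measure /pushforward.
have -> : @rV_cons R m @^-1` cube a r =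
    `[a ord0 ord0 - r, a ord0 ord0 + r] `*`
    cube (\row_j a ord0 (lift ord0 j)) r.
  apply/seteqP; split => -[t v] /=.
    move=> H; split; first by have := H ord0; rewrite /= mxE unlift_none in_itv.
    by move=> j; have := H (lift ord0 j); rewrite /= !mxE liftK.
  move=> [+ H] i; rewrite /= in_itv/= !mxE => t0.
  case: unliftP => [j ->|->//].
  by have := H j; rewrite mxE.
rewrite product_measure1E//; last exact: measurable_cube.
rewrite IH exprS EFinM; congr (_ * _)%E.
apply: etrans (lebesgue_measure_itv _) _.
rewrite /= lte_fin ifT; last by lra.
by rewrite -EFinB; congr (_%:E); ring.
Qed.

End rV_borel.

(** * Integration on the sphere *)

Section sphere_measure_theory.
Variables (R : realType) (n : nat).
Local Notation E := 'rV[R]_n.+1.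
Local Notation S := (@sphere R n).
Local Notation dV := (@sphere_vol R n).
Implicit Types (f g : E -> R).

Lemma continuous_normv m : continuous (@normv R m).
Proof.
move=> x; apply: (@continuous_comp _ _ _ (fun x : 'rV[R]_m => dotv x x) Num.sqrt).
  exact/differentiable_continuous/differentiable_dotv.
exact: sqrt_continuous.
Qed.

Lemma normr_coord_normv m (x : 'rV[R]_m) i : `|x ord0 i| <= normv x.
Proof.
rewrite -(ler_pXn2r (n := 2)) ?nnegrE ?normv_ge0// sqr_normv real_normK ?num_real//.
rewrite /dotv (bigD1 i)//= expr2 lerDl.
by apply: sumr_ge0 => j _; rewrite -expr2 sqr_ge0.
Qed.

Lemma closed_sphere : closed S.
Proof.
rewrite (_ : S = @normv R n.+1 @^-1` [set 1]); last by apply/seteqP; split.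
apply: closed_comp => [x _|]; first exact: continuous_normv.
exact: closed_eq.
Qed.

Lemma measurable_sphere : measurable S.
Proof.
by have /closed_openC/open_measurable_rV/measurableC := closed_sphere; rewrite setCK.
Qed.

Lemma compact_sphere : compact S.
Proof.
apply: bounded_closed_compact; last exact: closed_sphere.
exists 1; split; first exact: num_real.
move=> M M1 x Sx; rewrite /Num.Def.normr/= mx_normrE.
apply: bigmax_le => [|[i j] _]; first by rewrite ltW// (lt_trans ltr01).
rewrite ord1/= (le_trans (normr_coord_normv x j))// Sx; exact: ltW.
Qed.

Lemma sphere_volE (A : set E) : dV A =
  (n.+1%:R%:E * lebesgue_rV R n.+1
    (@unitv R n.+1 @^-1` A `&` [set x : E | (0 < normv x <= 1)%R]))%E.
Proof. by []. Qed.

Lemma measurable_cone (A : set E) : measurable A ->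
  measurable (@unitv R n.+1 @^-1` A `&` [set x : E | (0 < normv x <= 1)%R]).
Proof.
move=> mA; apply: measurableI; last exact: measurable_cone_ball.
by rewrite -[X in measurable X]setTI; exact: measurable_unitv.
Qed.

Lemma sphere_vol_fin (A : set E) : measurable A -> (dV A < +oo)%E.
Proof.
move=> mA; rewrite sphere_volE lte_mul_pinfty// ?lee_fin//.
apply: (@le_lt_trans _ _ (lebesgue_rV R n.+1 (cube 0 1))).
  apply: le_measure; rewrite ?inE; [exact: measurable_cone|exact: measurable_cube|].
  move=> x [_ /= /andP[_ x1]] i; rewrite mxE sub0r add0r -ler_norml.
  exact: le_trans (normr_coord_normv x i) x1.
by rewrite lebesgue_rV_cube// ltry.
Qed.

(** The cone over the neighborhood contains a small cube around x / 2. *)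
Lemma sphere_vol_nbhs_gt0 (x : E) (V : set E) : S x -> open V -> V x ->
  (0 < dV (V `&` S))%E.
Proof.
move=> Sx oV Vx; have x0 := normv1_neq0 Sx.
have h0 : 0 < 2^-1 :> R by rewrite invr_gt0.
pose y : E := 2^-1 *: x.
have uy : unitv y = x by rewrite unitvZ// unitv_id.
have y0 : y != 0 by rewrite scaler_eq0 negb_or x0 gt_eqF.
have ny : normv y = 2^-1 by rewrite normvZ Sx mulr1 gtr0_norm.
have cu : {for y, continuous (@unitv R n.+1)}.
  exact/differentiable_continuous/differentiable_unitv.
have n1 : \forall z \near y, V (unitv z).
  by apply: cu; rewrite uy; exact: open_nbhs_nbhs.
have n2 : \forall z \near y, 0 < normv z.
  have := @continuous_normv n.+1 y; rewrite /continuous_at ny => /cvgr_gt; exact.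
have n3 : \forall z \near y, normv z < 1.
  have := @continuous_normv n.+1 y; rewrite /continuous_at ny => /cvgr_lt; apply.
  by rewrite invf_lt1// ltr1n.
have : \forall z \near y, [/\ V (unitv z), 0 < normv z & normv z < 1].
  by apply: filterS3 n1 n2 n3.
move=> /nbhs_ballP[e /= e0 ye].
rewrite sphere_volE mule_gt0// ?lte_fin//.
have e40 : 0 < e / 4 by rewrite divr_gt0.
apply: (@lt_le_trans _ _ (lebesgue_rV R n.+1 (cube y (e / 4)))).
  by rewrite lebesgue_rV_cube// lte_fin exprn_gt0// addr_gt0.
apply: le_measure; rewrite ?inE; [exact: measurable_cube| |].
  apply: measurable_cone; apply: measurableI; last exact: measurable_sphere.
  exact: open_measurable_rV.
have yc : cube y (e / 4) y by move=> i; apply/andP; split; lra.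
move=> z /(cube_sub_ball e0 _ yc)-/(_ _)/ye[|Vz z0 z1]; first by lra.
split => /=; last by rewrite z0 ltW.
by split => //; apply: normv_unitv; rewrite -normv_gt0.
Qed.

Lemma integrable_sphere f : {within S, continuous f} -> dV.-integrable S (EFin \o f).
Proof.
move=> cf; apply: measurable_bounded_integrable.
- exact: measurable_sphere.
- by apply: sphere_vol_fin; exact: measurable_sphere.
- by apply: continuous_measurable_rV => //; exact: measurable_sphere.
- have /compact_bounded := continuous_compact cf compact_sphere.
  move=> [M [Mr HM]]; exists M; split => // N /HM{}HM x Sx.
  by apply: HM; exists x.
Qed.

Lemma Rintegral_sphere_gt0 f x : {within S, continuous f} ->
  (forall y, S y -> 0 <= f y) -> S x -> 0 < f x ->
  0 < \int[dV]_(y in S) f y.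
Proof.
move=> cf f0 Sx fx0; rewrite lt_def Rintegral_ge0// andbT; apply/eqP => I0.
have If := integrable_sphere cf.
have /integrableP[mf _] := If.
have : (\int[dV]_(y in S) `|(EFin \o f) y| = 0)%E.
  rewrite (eq_integral (EFin \o f)) => [|y]; last first.
    by rewrite inE => Sy /=; rewrite ger0_norm// f0.
  have := integrable_fin_num measurable_sphere If.
  by move=> /fineK <-; rewrite -[fine _]/(\int[dV]_(y in S) f y) I0.
move=> /(ae_eq_integral_abs _ measurable_sphere mf)[N [mN N0 fN]].
have /continuousP/(_ [set y : R | 0 < y] (@open_gt _ 0)) := cf.
move=> /open_subspaceP[V oV VS].
have [Vx _] : (V `&` S) x by rewrite VS.
have := sphere_vol_nbhs_gt0 Sx oV Vx.
rewrite lt_neqAle => /andP[/eqP + _]; apply; apply/esym.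
apply: (@subset_measure0 _ _ _ dV (V `&` S) N) => //.
  by apply: measurableI; [exact: open_measurable_rV|exact: measurable_sphere].
rewrite VS => y [/= fy Sy]; apply: fN => /= /(_ Sy) [] fy0.
by move: (fy : 0 < f y); rewrite fy0 ltxx.
Qed.

End sphere_measure_theory.
(** * Continuity on the sphere and exact forms *)

Section continuity_on_sphere.
Variables (R : realType) (n : nat).
Local Notation E := 'rV[R]_n.+1.
Local Notation S := (@sphere R n).
Local Notation nz := [set x : E | x != 0].
Implicit Types (f g : E -> R) (a b : E -> E).

Lemma within_ext f g : {within S, continuous f} ->
  (forall x, S x -> f x = g x) -> {within S, continuous g}.
Proof.
move=> + fg; apply: subspace_eq_continuous => x.
by rewrite inE => /fg.
Qed.

Lemma within_cst (c : R) : {within S, continuous (fun _ : E => c)}.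
Proof. by apply: continuous_subspaceT => x; exact: cst_continuous. Qed.

Lemma withinD f g : {within S, continuous f} -> {within S, continuous g} ->
  {within S, continuous (fun x => f x + g x)}.
Proof. by move=> cf cg x; exact: (cvgD (cf x) (cg x)). Qed.

Lemma withinM f g : {within S, continuous f} -> {within S, continuous g} ->
  {within S, continuous (fun x => f x * g x)}.
Proof. by move=> cf cg x; exact: (cvgM (cf x) (cg x)). Qed.

Lemma withinX f k : {within S, continuous f} ->
  {within S, continuous (fun x => f x ^+ k)}.
Proof.
move=> cf; elim: k => [|k IH].
  by refine (within_ext (@within_cst 1) _) => x _; rewrite expr0.
by refine (within_ext (withinM cf IH) _) => x _; rewrite exprS.
Qed.

Lemma within_sum (I : Type) (r : seq I) (P : pred I) (F : I -> E -> R) :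
  (forall i, {within S, continuous (F i)}) ->
  {within S, continuous (fun x => \sum_(i <- r | P i) F i x : R)}.
Proof.
move=> cF; elim: r => [|i r IH].
  by refine (within_ext (@within_cst 0) _) => x _; rewrite big_nil.
case Pi: (P i).
  by refine (within_ext (withinD (cF i) IH) _) => x _; rewrite big_cons Pi.
by refine (within_ext IH _) => x _; rewrite big_cons Pi.
Qed.

Lemma within_sqrt f : {within S, continuous f} ->
  {within S, continuous (fun x => Num.sqrt (f x))}.
Proof.
move=> cf x; apply: (@continuous_comp _ _ _ (f : subspace S -> R) Num.sqrt).
  exact: cf.
exact: sqrt_continuous.
Qed.

(** The power x `^ (k / 2), as a function on R, is not continuous at 0, where it
jumps to 1 on the left; on nonnegative x it is the power (sqrt x)^k. *)
Lemma within_powR_half f k : {within S, continuous f} -> (forall x, 0 <= f x) ->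
  {within S, continuous (fun x => f x `^ (k%:R / 2))}.
Proof.
move=> cf f0; refine (within_ext (@withinX _ k (within_sqrt cf)) _) => x _.
by rewrite mulrC powRrM powR12_sqrt// powR_mulrn// sqrtr_ge0.
Qed.

Lemma within_hom0 f : (forall x, x != 0 -> {for x, continuous (hom0 f)}) ->
  {within S, continuous f}.
Proof.
move=> cf; apply: (@within_ext (hom0 f)) => [|x Sx]; last exact: hom0_sphere.
by apply: continuous_in_subspaceT => x; rewrite inE => /normv1_neq0/cf.
Qed.

Lemma within_coord (i : 'I_n.+1) : {within S, continuous (fun x : E => x ord0 i)}.
Proof.
by apply: continuous_subspaceT => x; exact/differentiable_continuous/differentiable_coord.
Qed.

Lemma within_smooth a i : smooth a -> {within S, continuous (fun x => a x ord0 i)}.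
Proof.
move=> sa; apply: within_hom0 => x x0; apply: differentiable_continuous.
exact: (differentiable_rVP _ _).1 (smooth_differentiable sa x0) i.
Qed.

Lemma nabla_coord a x i j : smooth a -> S x -> nabla a x i j =
  \sum_k \sum_l tproj x i l * 'D_(delta_mx 0 l) (hom0 a) x ord0 k * tproj x k j.
Proof.
move=> sa Sx; rewrite /nabla mxE; apply: eq_bigr => k _.
rewrite mxE mulr_suml; apply: eq_bigr => l _; congr (_ * _ * _).
rewrite deriveEjacobian; last exact/smooth_differentiable/normv1_neq0.
by rewrite -rowE [RHS]mxE.
Qed.

Lemma within_tproj i j : {within S, continuous (fun x : E => tproj x i j)}.
Proof.
apply: (@within_ext (fun x => (i == j)%:R + -1 * (x ord0 i * x ord0 j))).
  apply: withinD; first exact: within_cst.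
  apply: withinM; first exact: within_cst.
  by apply: withinM; exact: within_coord.
move=> x _; rewrite !mxE mulN1r; congr (_ - _).
by rewrite big_ord1 !mxE !ord1.
Qed.

Lemma within_nabla a i j : smooth a -> {within S, continuous (fun x => nabla a x i j)}.
Proof.
move=> sa; refine (within_ext _ (fun x Sx => esym (nabla_coord i j sa Sx))).
do 2 (apply: within_sum => ?).
apply: withinM; last exact: within_tproj.
apply: withinM; first exact: within_tproj.
apply: continuous_in_subspaceT => x; rewrite inE => /normv1_neq0 x0.
apply: differentiable_continuous.
exact: (differentiable_rVP _ _).1 (smooth_derive_differentiable _ sa x0) _.
Qed.

Lemma within_normv a : smooth a -> {within S, continuous (fun x => normv (a x))}.
Proof.
move=> sa; apply/within_sqrt/within_sum => i.
by apply: withinM; exact: within_smooth.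
Qed.

Lemma within_norm_tensor (A : E -> 'M[R]_n.+1) :
  (forall i j, {within S, continuous (fun x => A x i j)}) ->
  {within S, continuous (fun x => norm_tensor (A x))}.
Proof.
move=> cA; apply/within_sqrt/within_sum => i; apply/within_sum => j.
exact: withinX.
Qed.

Lemma within_curl a : smooth a ->
  {within S, continuous (fun x => norm_form n.-2 (curl (smooth_jet a) x))}.
Proof.
move=> sa; apply/within_sqrt/withinM; first exact: within_cst.
apply/within_sum => s; apply/withinX; rewrite /curl /hodge2.
apply: within_sum => i; apply: within_sum => j; apply: withinM.
  apply: (@within_ext (fun x => nabla a x i j + -1 * nabla a x j i)).
    apply: withinD; first exact: within_nabla.
    by apply: withinM; [exact: within_cst|exact: within_nabla].
  by move=> x _; rewrite /= /extd !mxE mulN1r.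
refine (within_ext _ (fun x _ => esym (volume_form_sum x _))).
apply: within_sum => c; apply: withinM; first exact: within_coord.
exact: within_cst.
Qed.

Lemma norm_form_ge0 k (b : seq E -> R) : 0 <= norm_form k b.
Proof. exact: sqrtr_ge0. Qed.

Lemma norm_tensor_ge0 (A : 'M[R]_n.+1) : 0 <= norm_tensor A.
Proof. exact: sqrtr_ge0. Qed.

Lemma norm_tensorZ (t : R) (A : 'M[R]_n.+1) :
  norm_tensor (t *: A) = `|t| * norm_tensor A.
Proof.
rewrite /norm_tensor.
have -> : \sum_i \sum_j (t *: A) i j ^+ 2 = t ^+ 2 * \sum_i \sum_j A i j ^+ 2.
  rewrite mulr_sumr; apply: eq_bigr => i _; rewrite mulr_sumr.
  by apply: eq_bigr => j _; rewrite mxE exprMn.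
by rewrite sqrtrM ?sqr_ge0// sqrtr_sqr.
Qed.

Lemma nablaDZ a b t x : smooth a -> smooth b -> S x ->
  nabla (fun y => a y + t *: b y) x = nabla a x + t *: nabla b x.
Proof.
move=> sa sb Sx; have x0 := normv1_neq0 Sx.
have da := smooth_differentiable sa x0; have db := smooth_differentiable sb x0.
have dtb := differentiableZ t db.
have -> : nabla (fun y => a y + t *: b y) x =
    tproj x *m ('J (hom0 a) x + t *: 'J (hom0 b) x) *m tproj x.
  rewrite /nabla; congr (_ *m _ *m _); apply/row_matrixP => i; rewrite !rowE.
  set e := delta_mx 0 i.
  have E1 := deriveEjacobian e (differentiableD da dtb).
  have E2 := deriveD (diff_derivable (v := e) da) (diff_derivable (v := e) dtb).
  have E3 := deriveZ t (diff_derivable (v := e) db).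
  apply: etrans (esym E1) _; apply: etrans E2 _.
  apply: etrans (congr1 (fun u => 'D_e (hom0 a) x + u) E3) _.
  rewrite mulmxDr -scalemxAr.
  exact: (congr2 (fun u v => u + t *: v) (deriveEjacobian e da) (deriveEjacobian e db)).
by rewrite (mulmxDr (tproj x) ('J _ _)) mulmxDl -scalemxAr -scalemxAl.
Qed.

Lemma smooth_formDZ a b t : smooth_form a -> smooth_form b ->
  smooth_form (fun y => a y + t *: b y).
Proof.
move=> [ta sa] [tb sb]; split.
  by move=> x Sx; rewrite /tangent dotvDr dotvZr ta// tb// mulr0 addr0.
move=> k; have onz := @open_neq0 R n.+1.
have /(ndifferentiable_rVP _ _ onz) ca := sa k.
have /(ndifferentiable_rVP _ _ onz) cb := sb k.
apply/ndifferentiable_rVP => // j.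
rewrite (_ : (fun x => _) =
    (fun x => hom0 a x ord0 j + (cst t : E -> R) x * hom0 b x ord0 j)); last first.
  by apply/funext => x; rewrite /hom0 !mxE.
apply: ndifferentiableD => //; apply: ndifferentiableM => //.
exact: ndifferentiable_cst.
Qed.

Lemma tproj_idem (x : E) : S x -> tproj x *m tproj x = tproj x.
Proof.
by move=> Sx; rewrite {2}/tproj mulmxBr mulmx1 mulmxA (tproj_normal Sx) mul0mx subr0.
Qed.

Lemma tproj_nabla a x : S x -> tproj x *m nabla a x *m tproj x = nabla a x.
Proof.
move=> Sx; have TT := tproj_idem Sx.
by rewrite /nabla !mulmxA TT -!mulmxA TT.
Qed.

(** A tangential 2-tensor is determined by its values on the projections of the
basis vectors. *)
Lemma extd_eq0 a x : S x -> smooth a ->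
  (forall v w, tangent x v -> tangent x w ->
    dotv ('D_v (hom0 a) x) w - dotv ('D_w (hom0 a) x) v = 0) ->
  extd (nabla a x) = 0.
Proof.
move=> Sx sa closed; have Tt := tproj_sym x.
have TeT : extd (nabla a x) = tproj x *m extd (nabla a x) *m tproj x.
  rewrite /extd (mulmxBr (tproj x) (nabla a x)) (mulmxBl _ _ (tproj x)) tproj_nabla//.
  congr (_ - _).
  by rewrite -{1}(tproj_nabla a Sx) (trmx_mul (tproj x *m _)) (trmx_mul (tproj x)) Tt mulmxA.
have tT i : tangent x (row i (tproj x)).
  rewrite /tangent dotvC dotvE -row_mul tproj_normal//.
  by rewrite row0 mxE.
apply/matrixP => i j; rewrite TeT [RHS]mxE.
have -> : (tproj x *m extd (nabla a x) *m tproj x) i j =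
    (row i (tproj x) *m extd (nabla a x) *m (row j (tproj x))^T) ord0 ord0.
  rewrite -row_mul tr_row Tt -row_mul; rewrite !mxE.
  by apply: eq_bigr => k _; rewrite !mxE.
by rewrite extdE// closed.
Qed.

(** The differential of the restriction to the sphere of x |-> <x, c>. *)
Definition dlinear (c x : E) : E := c - dotv x c *: x.

Lemma smooth_form_dlinear c : smooth_form (dlinear c).
Proof.
split=> [x Sx|k].
  by rewrite /tangent /dlinear dotvDr dotvNr dotvZr dotv1// mulr1 subrr.
have onz := @open_neq0 R n.+1.
have /(ndifferentiable_rVP _ _ onz) su := @ndifferentiable_unitv R n.+1 k.
apply/ndifferentiable_rVP => // j.
rewrite (_ : (fun x => _) = (fun x : E => (cst (c ord0 j) : E -> R) x +
    (cst (-1) : E -> R) x * (dotv (unitv x) c * unitv x ord0 j))); last first.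
  by apply/funext => x; rewrite /hom0 !mxE /= mulN1r.
apply: ndifferentiableD => //; first exact: ndifferentiable_cst.
apply: ndifferentiableM => //; first exact: ndifferentiable_cst.
apply: ndifferentiableM => //.
apply: ndifferentiable_sum => // i; apply: ndifferentiableM => //.
exact: ndifferentiable_cst.
Qed.

(** The Hessian of x |-> <x, c> on the sphere is - <x, c> times the metric, hence
symmetric. *)
Lemma extd_dlinear c x : S x -> extd (nabla (dlinear c) x) = 0.
Proof.
move=> Sx; have x0 := normv1_neq0 Sx.
have [_ sd] := smooth_form_dlinear c.
apply: extd_eq0 => // v w xv xw.
have du := differentiable_unitv x0.
have Dd z y : tangent x z -> tangent x y ->
    dotv ('D_z (hom0 (dlinear c)) x) y = - (dotv x c * dotv z y).
  move=> xz xy.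
  have dcst (u : E) : differentiable (cst u : E -> E) x by exact: differentiable_cst.
  have dd := smooth_differentiable sd x0.
  have ux : unitv x = x by rewrite unitv_id.
  have dot u : 'D_z (fun t => dotv (unitv t) u) x = dotv z u.
    apply: etrans (derive_dotv2 z du (dcst u)) _.
    by rewrite derive_cst dotv0r addr0 derive_unitv.
  have ddot u : derivable (fun t => dotv (unitv t) u) x z.
    apply: diff_derivable; rewrite /dotv (_ : (fun t => _) =
        \sum_(i < n.+1) (fun t : E => unitv t ord0 i * u ord0 i)); last first.
      by apply/funext => t; rewrite fct_sumE.
    apply: differentiable_sum => i; apply: differentiableM => //.
    exact: (differentiable_rVP _ _).1 du i.
  have : 'D_z (fun t => dotv (hom0 (dlinear c) t) y) x =
      dotv ('D_z (hom0 (dlinear c)) x) y.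
    apply: etrans (derive_dotv2 z dd (dcst y)) _.
    by rewrite derive_cst dotv0r addr0.
  move=> <-.
  have -> : (fun t => dotv (hom0 (dlinear c) t) y) = cst (dotv c y) -
      (fun t => dotv (unitv t) c) * (fun t => dotv (unitv t) y).
    by apply/funext => t; rewrite /hom0 /dlinear dotvDl dotvNl dotvZl.
  apply: etrans (deriveB (derivable_cst _ _ _) (derivableM (ddot c) (ddot y))) _.
  rewrite derive_cst sub0r; congr (- _).
  apply: etrans (deriveM (ddot c) (ddot y)) _.
  by rewrite !dot ux (xy : dotv x y = 0) scale0r addr0.
apply: etrans (congr2 (fun s t => s - t) (Dd v w xv xw) (Dd w v xw xv)) _.
by rewrite (dotvC w v) subrr.
Qed.

End continuity_on_sphere.
(** * Perturbation by an exact form *)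

Section perturbation.
Variables (R : realType) (n : nat).
Local Notation E := 'rV[R]_n.+1.
Local Notation S := (@sphere R n).
Local Notation dV := (@sphere_vol R n).
Local Notation p := (n%:R / 2 : R).
Implicit Types a b : E -> E.

Lemma ltr_quotient (N m1 m2 : R) : 0 < N -> 0 < m1 -> m1 < m2 ->
  N ^+ 2 / m2 < N ^+ 2 / m1.
Proof.
move=> N0 m10 m12; rewrite ltr_pM2l ?exprn_gt0// ltf_pV2 ?posrE//.
exact: lt_trans m12.
Qed.

Definition energy a : R := \int[dV]_(x in S) (norm_form n.-2 (curl (smooth_jet a) x) `^ p).

Definition mass a : R := \int[dV]_(x in S) (normv (a x) ^+ n).

Lemma extdDZ (A B : 'M[R]_n.+1) t : extd (A + t *: B) = extd A + t *: extd B.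
Proof. by rewrite /extd linearD/= linearZ/= scalerBr opprD addrACA. Qed.

Lemma energyDZ a b t : smooth a -> smooth b ->
  (forall x, S x -> extd (nabla b x) = 0) ->
  energy (fun x => a x + t *: b x) = energy a.
Proof.
move=> sa sb closed; apply: eq_Rintegral => x; rewrite inE => Sx.
have H : extd (nabla (fun x => a x + t *: b x) x) = extd (nabla a x).
  apply: etrans (congr1 (@extd R n) (nablaDZ t sa sb Sx)) _.
  apply: etrans (extdDZ _ _ _) _.
  apply: etrans (congr1 (fun u => extd (nabla a x) + t *: u) (closed x Sx)) _.
  by rewrite scaler0 addr0.
exact: (congr1 (fun w => norm_form n.-2 (hodge2 x w) `^ p) H).
Qed.

Lemma energy_gt0 a x : (2 <= n)%N -> smooth a -> S x -> extd (nabla a x) != 0 ->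
  0 < energy a.
Proof.
move=> n2 sa Sx d0; apply: (@Rintegral_sphere_gt0 _ _ _ x) => //.
- by apply: within_powR_half; [exact: within_curl|move=> y; exact: norm_form_ge0].
- by move=> y _; exact: powR_ge0.
apply: powR_gt0; apply: norm_form_hodge2_gt0 => //; first exact: extd_tr.
exact: extd_nabla_normal.
Qed.

Lemma mass_gt0 a x : smooth a -> S x -> a x != 0 -> 0 < mass a.
Proof.
move=> sa Sx ax0; apply: (@Rintegral_sphere_gt0 _ _ _ x) => //.
- by apply: withinX; exact: within_normv.
- by move=> y _; rewrite exprn_ge0// normv_ge0.
by rewrite exprn_gt0// normv_gt0.
Qed.

Lemma integrable_mass a : smooth a ->
  dV.-integrable S (EFin \o (fun x => normv (a x) ^+ n)).
Proof. by move=> sa; apply: integrable_sphere; apply: withinX; exact: within_normv. Qed.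

Lemma mass_clarkson a b t : (2 <= n)%N -> smooth_form a -> smooth_form b ->
  2 * (mass a + `|t| ^+ n * mass b) <=
  mass (fun x => a x + t *: b x) + mass (fun x => a x + (- t) *: b x).
Proof.
move=> n2 sa sb; have mS := @measurable_sphere R n.
have ia := integrable_mass sa.2; have ib := integrable_mass sb.2.
have ip := integrable_mass (smooth_formDZ t sa sb).2.
have im := integrable_mass (smooth_formDZ (- t) sa sb).2.
have itb : dV.-integrable S (EFin \o (fun x => `|t| ^+ n * normv (b x) ^+ n)).
  apply: integrable_sphere; apply: withinM; first exact: within_cst.
  by apply: withinX; exact: within_normv sb.2.
have iab : dV.-integrable S
    (EFin \o (fun x => normv (a x) ^+ n + `|t| ^+ n * normv (b x) ^+ n)).
  apply: integrable_sphere; apply: withinD.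
    by apply: withinX; exact: within_normv sa.2.
  apply: withinM; first exact: within_cst.
  by apply: withinX; exact: within_normv sb.2.
rewrite /mass -(RintegralZl _ mS ib) -(RintegralD mS ia itb) -(RintegralD mS ip im).
rewrite -(RintegralZl _ mS iab); apply: le_Rintegral => //.
- apply: integrable_sphere; apply: withinM; first exact: within_cst.
  apply: withinD; first by apply: withinX; exact: within_normv sa.2.
  apply: withinM; first exact: within_cst.
  by apply: withinX; exact: within_normv sb.2.
- apply: integrable_sphere.
  by apply: withinD; apply: withinX; exact: within_normv (smooth_formDZ _ sa sb).2.
move=> x Sx; rewrite scaleNr -exprMn -normvZ.
have nE : n.-2.+2 = n by case: (n) n2 => [|[|]].
by have := clarkson (a x) (t *: b x) n.-2; rewrite nE.
Qed.

Definition sobolev_const b : R :=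
  (\int[dV]_(x in S) (normv (b x) `^ p + norm_tensor (nabla b x) `^ p)) `^ p^-1.

(** The difference of the two jets is t times the jet of b. *)
Lemma sobolev_distDZ a b t : (0 < n)%N -> smooth a -> smooth b ->
  sobolev_dist p (smooth_jet (fun x => a x + t *: b x)) (smooth_jet a) =
  (`|t| * sobolev_const b)%:E.
Proof.
move=> n0 sa sb; have mS := @measurable_sphere R n.
have p0 : p != 0 by rewrite mulf_neq0 ?invr_eq0 ?pnatr_eq0 -?lt0n.
pose k x := normv (b x) `^ p + norm_tensor (nabla b x) `^ p.
have k0 x : 0 <= k x by rewrite addr_ge0 ?powR_ge0.
have ck : {within S, continuous k}.
  apply: withinD.
    by apply: within_powR_half; [exact: within_normv|move=> y; exact: normv_ge0].
  apply: within_powR_half; last by move=> y; exact: norm_tensor_ge0.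
  by apply: within_norm_tensor => i j; exact: within_nabla.
have ik := integrable_sphere ck.
rewrite /sobolev_dist (eq_integral (fun x => (`|t| `^ p)%:E * (k x)%:E)%E); last first.
  move=> x; rewrite inE => Sx; rewrite /= nablaDZ// ![_ + _ - _]addrAC !subrr !add0r.
  rewrite normvZ norm_tensorZ !powRM ?normv_ge0 ?norm_tensor_ge0//.
  by rewrite -mulrDr EFinM.
rewrite integralZl// -(fineK (integrable_fin_num mS ik)) -EFinM poweR_EFin.
congr (_%:E); rewrite powRM ?powR_ge0//; last by apply: Rintegral_ge0 => x _; exact: k0.
by rewrite -powRrM mulfV// powRr1.
Qed.

Lemma sobolev_smooth_jet a : (0 < n)%N -> smooth_form a -> sobolev p (smooth_jet a).
Proof.
move=> n0 [ta sa]; split => //=.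
- move=> i; apply: continuous_measurable_rV; first exact: measurable_sphere.
  exact: within_smooth.
- move=> i j; apply: continuous_measurable_rV; first exact: measurable_sphere.
  exact: within_nabla.
- by move=> x Sx; exact: tproj_nabla.
move=> e e0; exists a; split => //.
have p0 : p != 0 by rewrite mulf_neq0 ?invr_eq0 ?pnatr_eq0 -?lt0n.
have n00 m : normv (0 : 'rV[R]_m) = 0 by rewrite /normv dotv0l sqrtr0.
have t00 : norm_tensor (0 : 'M[R]_n.+1) = 0.
  by rewrite -(scale0r 0) norm_tensorZ normr0 mul0r.
rewrite /sobolev_dist (eq_integral (cst 0%E)); last first.
  by move=> x _; rewrite /= !subrr n00 t00 powR0// addr0.
by rewrite integral0 poweR0r ?invr_eq0// lte_fin.
Qed.

Lemma mass_not_identically_zero a : smooth a -> 0 < mass a ->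
  (0 < n)%N -> not_identically_zero (smooth_jet a).
Proof.
move=> sa + n0 a0; rewrite /mass /Rintegral (@ae_eq_integral _ _ _ _ _ (cst 0%E)).
- by rewrite integral0 ltxx.
- exact: measurable_sphere.
- by have /integrableP[] := integrable_mass sa.
- exact: measurable_cst.
apply: filterS a0 => x H /H /= ->.
by rewrite /normv dotv0l sqrtr0 expr0n gtn_eqF.
Qed.

End perturbation.

Theorem theorem1p3 (R : realType) (n : nat) (hn : (3 <= n)%N) (hodd : odd n)
    (xi : 'rV[R]_n.+1 -> 'rV[R]_n.+1) (hxi : calM xi) :
  ~ local_minimizer (smooth_jet xi).
Proof.
move=> [e [e0 xi_min]].
have n2 : (2 <= n)%N by exact: leq_trans hn.
have n0 : (0 < n)%N by exact: leq_trans hn.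
have sxi := calM_smooth_form hxi.
have [x [Sx dx0]] := calM_extd_neq0 n2 hxi.
have Exi := energy_gt0 n2 sxi.2 Sx dx0.
(* The form dlinear c does not vanish at c', which is orthogonal to c. *)
pose c := @basis_vec R n ord0; pose c' := @basis_vec R n ord_max.
have sb := smooth_form_dlinear c.
have closed := extd_dlinear c.
have c'1 : normv c' = 1.
  by rewrite /normv dotv_delta mxE !eqxx sqrtr1.
have bc' : dlinear c c' != 0.
  have ord0max : (@ord0 n == ord_max) = false.
    by apply/negbTE; rewrite -val_eqE/= eq_sym -lt0n.
  have cc' : dotv c' c = 0 by rewrite dotv_delta mxE ord0max andbF.
  rewrite /dlinear cc' scale0r subr0.
  by apply/negP => /eqP/rowP/(_ ord0)/eqP; rewrite !mxE !eqxx oner_eq0.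
have Mb := mass_gt0 sb.2 c'1 bc'.
have Mxi : 0 < mass xi.
  have [y Sy ay] : exists2 y, @sphere R n y & xi y != 0.
    apply: contrapT => xi0; move/eqP: dx0; apply.
    apply: extd_eq0 => //; first exact: sxi.2.
    have xiz y : y != 0 -> hom0 xi y = 0.
      move=> y0; apply/eqP/negP => /negP ?; apply: xi0.
      by exists (unitv y) => //; exact: normv_unitv.
    have D0 z : 'D_z (hom0 xi) x = 0.
      exact: (derive_locally_cst _ (@open_neq0 R n.+1) (normv1_neq0 Sx) xiz).
    by move=> v w _ _; rewrite !D0 !dotv0l subrr.
  exact: mass_gt0 sxi.2 Sy ay.
pose K := sobolev_const (dlinear c).
have K0 : 0 <= K by exact: powR_ge0.
pose t := e / (K + 1).
have K1 : 0 < K + 1 by rewrite ltr_wpDl.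
have t0 : 0 < t by rewrite divr_gt0.
have tK : t * K < e by rewrite /t mulrAC ltr_pdivrMr// ltr_pM2l// ltrDl.
(* Minimality would force the mass not to increase in either direction. *)
have no_gain s : `|s| = t -> mass (fun x => xi x + s *: dlinear c x) <= mass xi.
  move=> st; rewrite leNgt; apply/negP => gain.
  have sv := smooth_formDZ s sxi sb.
  have := xi_min (smooth_jet (fun x => xi x + s *: dlinear c x)).
  rewrite (sobolev_distDZ s n0 sxi.2 sb.2).
  rewrite st lte_fin => /(_ (sobolev_smooth_jet n0 sv)).
  move=> /(_ (mass_not_identically_zero sv.2 (lt_trans Mxi gain) n0) tK) Jle.
  have Ev := energyDZ s sxi.2 sb.2 closed.
  have {}Jle : energy xi ^+ 2 / mass xi <=
      energy xi ^+ 2 / mass (fun x => xi x + s *: dlinear c x).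
    exact: (eq_ind _ (fun q => _ <= q ^+ 2 / _) Jle _ Ev).
  by have := lt_le_trans (ltr_quotient Exi Mxi gain) Jle; rewrite ltxx.
have := mass_clarkson t n2 sxi sb.
have := lerD (no_gain t (gtr0_norm t0)) (no_gain (- t) _).
rewrite normrN gtr0_norm// => /(_ erefl) le1 le2.
have pos : 0 < t ^+ n * mass (dlinear c) by rewrite mulr_gt0// exprn_gt0.
have aux (m q : R) : 0 < q -> ~ (2 * (m + q) <= m + m).
  by move=> q0; apply/negP; rewrite -ltNge mulr_natl mulr2n ltrD// ltrDl.
exact: aux pos (le_trans le2 le1).
Qed.
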